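(* Let $F$ be a perfect field of characteristic $p>0$ and let $G$ be a restricted Lie algebra over $F$ given by a presentation with $n$ generators and $m$ relations, where $m\le n-2$. Then there is a natural number $N$ such that for every cyclic restricted Lie algebra $A$ over $F$ of finite dimension at least $N$, $G$ has a restricted ideal $M$ with $G/M\cong A$ such that $M$ admits a surjective homomorphism onto a nonabelian free restricted Lie algebra.
   Context: All subalgebras and ideals of restricted Lie algebras are understood to be restricted, i.e. closed under the $p$-operation $x\mapsto x^{[p]}$. Presentation: let $L=L(X)$ be the free restricted Lie algebra over $F$ with free generators $X=\{x_1,\dots,x_n\}$, let $W=\{w_1,\dots,w_m\}\subset L$, and let $I$ be the restricted ideal of $L$ generated by $W$; then $G=L/I$ is said to be presented by $n$ generators and $m$ relations. A restricted Lie algebra $A$ is cyclic if it is generated, as a restricted Lie algebra, by a single element. A free restricted Lie algebra is nonabelian iff its rank is at least 2. *)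

(* Defs.v *)
From HB Require Import structures.
From mathcomp Require Import all_boot all_order all_algebra.
From mathcomp Require Import boolp.

Set Implicit Arguments.
Unset Strict Implicit.
Unset Printing Implicit Defensive.

Import GRing.Theory.
Local Open Scope ring_scope.
Local Open Scope quotient_scope.

Declare Scope lie_scope.
Delimit Scope lie_scope with lie.

HB.mixin Record Lmodule_isLie (F : fieldType) V of GRing.Lmodule F V := {
  bracket : V -> V -> V;
  bracketDl : forall x y z, bracket (x + y) z = bracket x z + bracket y z;
  bracketDr : forall x y z, bracket x (y + z) = bracket x y + bracket x z;
  bracketZl : forall a x y, bracket (a *: x) y = a *: bracket x y;
  bracketZr : forall a x y, bracket x (a *: y) = a *: bracket x y;
  bracketxx : forall x, bracket x x = 0;
  bracket_jacobi : forall x y z,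
    bracket x (bracket y z) + bracket y (bracket z x)
      + bracket z (bracket x y) = 0
}.

#[short(type="lieType")]
HB.structure Definition Lie (F : fieldType) :=
  { V of GRing.Lmodule F V & Lmodule_isLie F V }.

Notation "⁅ x , y ⁆" := (bracket x y)
  (at level 0, x at level 99, y at level 99, format "⁅ x ,  y ⁆") : lie_scope.
Local Open Scope lie_scope.

Section AdCoef.
Variables (F : fieldType) (L : lieType F).
Implicit Types x y : L.

Lemma bracket0r x : ⁅x, 0⁆ = 0.
Proof. by have := bracketZr 0 x 0; rewrite !scale0r. Qed.

Lemma bracketC x y : ⁅x, y⁆ = - ⁅y, x⁆.
Proof.
apply/eqP; rewrite -addr_eq0.
by have := bracketxx (x + y); rewrite bracketDl !bracketDr !bracketxx
  add0r addr0 => ->.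
Qed.

(* The coefficient of t ^ j in (ad (t x + y)) ^ k (x), computed in
   L (x) F[t] by expanding [t x + y, -]. *)
Fixpoint adcoef x y (k j : nat) : L :=
  if k is k'.+1 then
    (if j is j'.+1 then ⁅x, adcoef x y k' j'⁆ else 0) + ⁅y, adcoef x y k' j⁆
  else if j is 0 then x else 0.

(* Jacobson's terms: i s_i(x, y) is the coefficient of t ^ (i - 1) in
   (ad (t x + y)) ^ (p - 1) (x); used only for 1 <= i < p, where i is
   invertible in F. *)
Definition jacobson_s (p : nat) x y (i : nat) : L :=
  i%:R^-1 *: adcoef x y p.-1 i.-1.

End AdCoef.

(* The characteristic p of F is a parameter of the structure; the hypothesis
   p \in [pchar F] is left to the statements that use it. *)
HB.mixin Record Lie_isRestricted (p : nat) (F : fieldType) V of Lie F V := {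
  rpow : V -> V;
  rpowZ : forall (a : F) x, rpow (a *: x) = a ^+ p *: rpow x;
  bracket_rpow : forall x y : V, ⁅rpow x, y⁆ = iter p (bracket x) y;
  rpowD : forall x y : V,
    rpow (x + y) = rpow x + rpow y + \sum_(1 <= i < p) jacobson_s p x y i
}.

#[short(type="rlieType")]
HB.structure Definition RestrictedLie (p : nat) (F : fieldType) :=
  { V of Lie F V & Lie_isRestricted p F V }.

Notation "x ^[ p ]" := (@rpow p _ _ x)
  (at level 2, left associativity, format "x ^[ p ]") : lie_scope.

#[short(type="rlieVectType")]
HB.structure Definition RestrictedLieVect (p : nat) (F : fieldType) :=
  { V of RestrictedLie p F V & Vector F V }.

Section Morphisms.
Variables (p : nat) (F : fieldType).

Record rlie_hom (L H : rlieType p F) (f : L -> H) : Prop := RLieHom {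
  rlie_hom_linear : linear f;
  rlie_hom_bracket : forall x y, f ⁅x, y⁆ = ⁅f x, f y⁆;
  rlie_hom_rpow : forall x, f x^[p] = (f x)^[p]
}.

Definition rlie_isom (L H : rlieType p F) : Prop :=
  exists f : L -> H, rlie_hom f /\ bijective f.

Definition rlie_free_on (X : Type) (L : rlieType p F) (x : X -> L) : Prop :=
  forall (H : rlieType p F) (h : X -> H),
    exists f : L -> H,
      [/\ rlie_hom f, forall i, f (x i) = h i
        & forall g : L -> H, rlie_hom g -> (forall i, g (x i) = h i) ->
            forall z, g z = f z].

Definition rlie_free (L : rlieType p F) : Prop :=
  exists (X : Type) (x : X -> L), rlie_free_on x.

Definition rlie_abelian (L : rlieType p F) : Prop :=
  forall x y : L, ⁅x, y⁆ = 0.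

End Morphisms.

Section Subobjects.
Variables (p : nat) (F : fieldType) (L : rlieType p F).

Record rsubalg := RSubalg {
  rsubalg_pred :> {pred L};
  rsubalg_submod : submod_closed rsubalg_pred;
  rsubalg_bracket : {in rsubalg_pred &, forall x y, ⁅x, y⁆ \in rsubalg_pred};
  rsubalg_rpow : {in rsubalg_pred, forall x, x^[p] \in rsubalg_pred}
}.

Record rideal := RIdeal {
  rideal_pred :> {pred L};
  rideal_submod : submod_closed rideal_pred;
  rideal_bracket : forall x, {in rideal_pred, forall y, ⁅x, y⁆ \in rideal_pred};
  rideal_rpow : {in rideal_pred, forall x, x^[p] \in rideal_pred}
}.

HB.instance Definition _ (S : rsubalg) :=
  GRing.isSubmodClosed.Build F L (rsubalg_pred S) (rsubalg_submod S).
HB.instance Definition _ (I : rideal) :=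
  GRing.isSubmodClosed.Build F L (rideal_pred I) (rideal_submod I).

Definition rideal_rsubalg (I : rideal) : rsubalg :=
  @RSubalg (rideal_pred I) (rideal_submod I)
    (fun x y _ yI => rideal_bracket x yI) (@rideal_rpow I).

Definition rlie_cyclic : Prop :=
  exists a : L, forall S : rsubalg, a \in S -> forall x, x \in S.

Section Generated.
Variables (T : Type) (w : T -> L).

Definition rideal_gen_pred : {pred L} :=
  fun x => `[< forall J : rideal, (forall i, w i \in J) -> x \in J >].

Lemma rideal_gen_submod : submod_closed rideal_gen_pred.
Proof.
split=> [|a x y /asboolP xI /asboolP yI]; apply/asboolP => J wJ.
  exact: rpred0.
by rewrite rpredD ?rpredZ ?xI ?yI.
Qed.

Lemma rideal_gen_bracket x :
  {in rideal_gen_pred, forall y, ⁅x, y⁆ \in rideal_gen_pred}.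
Proof.
by move=> y /asboolP yI; apply/asboolP => J wJ; apply/rideal_bracket/yI.
Qed.

Lemma rideal_gen_rpow :
  {in rideal_gen_pred, forall x, x^[p] \in rideal_gen_pred}.
Proof.
by move=> x /asboolP xI; apply/asboolP => J wJ; apply/rideal_rpow/xI.
Qed.

Definition rideal_gen : rideal :=
  RIdeal rideal_gen_submod rideal_gen_bracket rideal_gen_rpow.

End Generated.
End Subobjects.

Section SubAlgebra.
Variables (p : nat) (F : fieldType) (L : rlieType p F) (S : rsubalg L).

Record rsub : predArgType := RSub { rsub_val :> L; _ : rsub_val \in S }.

HB.instance Definition _ := [isSub for rsub_val].
HB.instance Definition _ := [Choice of rsub by <:].
HB.instance Definition _ := [SubChoice_isSubLmodule of rsub by <:].

Implicit Types u v : rsub.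

Definition sub_bracket u v : rsub :=
  RSub (rsubalg_bracket (valP u) (valP v)).
Definition sub_rpow u : rsub := RSub (rsubalg_rpow (valP u)).

Fact sub_bracketDl u v w :
  sub_bracket (u + v) w = sub_bracket u w + sub_bracket v w.
Proof. by apply/val_inj; rewrite /= bracketDl. Qed.
Fact sub_bracketDr u v w :
  sub_bracket u (v + w) = sub_bracket u v + sub_bracket u w.
Proof. by apply/val_inj; rewrite /= bracketDr. Qed.
Fact sub_bracketZl a u v : sub_bracket (a *: u) v = a *: sub_bracket u v.
Proof. by apply/val_inj; rewrite /= bracketZl. Qed.
Fact sub_bracketZr a u v : sub_bracket u (a *: v) = a *: sub_bracket u v.
Proof. by apply/val_inj; rewrite /= bracketZr. Qed.
Fact sub_bracketxx u : sub_bracket u u = 0.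
Proof. by apply/val_inj; rewrite /= bracketxx. Qed.
Fact sub_bracket_jacobi u v w :
  sub_bracket u (sub_bracket v w) + sub_bracket v (sub_bracket w u)
    + sub_bracket w (sub_bracket u v) = 0.
Proof. by apply/val_inj; rewrite /= bracket_jacobi. Qed.

HB.instance Definition _ := Lmodule_isLie.Build F rsub
  sub_bracketDl sub_bracketDr sub_bracketZl sub_bracketZr
  sub_bracketxx sub_bracket_jacobi.

Lemma val_adcoef u v k j :
  val (adcoef u v k j) = adcoef (val u) (val v) k j.
Proof. by elim: k j => [|k IH] [|j] //=; rewrite -!IH. Qed.

Fact sub_rpowZ a u : sub_rpow (a *: u) = a ^+ p *: sub_rpow u.
Proof. by apply/val_inj; rewrite /= rpowZ. Qed.
Fact sub_bracket_rpow u v : ⁅sub_rpow u, v⁆ = iter p (bracket u) v.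
Proof.
apply/val_inj; rewrite /= bracket_rpow -/(val u) -/(val v).
have iterE n : val (iter n (bracket u) v) = iter n (bracket (val u)) (val v).
  by elim: n => //= n <-.
by rewrite -iterE.
Qed.
Fact sub_rpowD u v : sub_rpow (u + v) =
  sub_rpow u + sub_rpow v + \sum_(1 <= i < p) jacobson_s p u v i.
Proof.
have valD (a b : rsub) : val (a + b) = val a + val b by exact: raddfD.
apply/val_inj; rewrite !valD (big_morph val valD (raddf0 val)) [LHS]rpowD.
by congr (_ + _); apply: eq_bigr => i _; rewrite /jacobson_s -val_adcoef.
Qed.

HB.instance Definition _ := Lie_isRestricted.Build p F rsub
  sub_rpowZ sub_bracket_rpow sub_rpowD.

Lemma rsub_val_hom : rlie_hom (rsub_val : rsub -> L).
Proof. by split. Qed.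

End SubAlgebra.

Section QuotientAlgebra.
Variables (p : nat) (F : fieldType) (L : rlieType p F) (I : rideal L).

Definition rquot := Quotient.quot (rideal_pred I).

HB.instance Definition _ := GRing.Zmodule.on rquot.

Definition rquot_pi (x : L) : rquot := \pi_rquot x.
Local Notation q := rquot_pi.

Lemma rquot_reprK : cancel (repr : rquot -> L) q.
Proof. exact: reprK. Qed.

Lemma rquotP (x y : L) : reflect (q x = q y) (x - y \in I).
Proof. by rewrite (Quotient.idealrBE I); apply: eqP. Qed.

Lemma rquotD (x y : L) : q (x + y) = q x + q y.
Proof. exact: (Quotient.pi_add I). Qed.

Lemma repr_rquot (x : L) : exists2 m, m \in I & repr (q x) = x + m.
Proof.
exists (repr (q x) - x); last by rewrite addrC subrK.
by apply/rquotP; rewrite rquot_reprK.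
Qed.

Definition quot_scale (a : F) (u : rquot) : rquot := q (a *: repr u).
Definition quot_bracket (u v : rquot) : rquot := q ⁅repr u, repr v⁆.
Definition quot_rpow (u : rquot) : rquot := q (repr u)^[p].

Lemma pi_scale a x : quot_scale a (q x) = q (a *: x).
Proof.
rewrite /quot_scale; have [m mI ->] := repr_rquot x; apply/rquotP.
by rewrite scalerDr addrC addKr rpredZ.
Qed.

Lemma rideal_bracketl x y : x \in I -> ⁅x, y⁆ \in I.
Proof. by move=> xI; rewrite bracketC rpredN rideal_bracket. Qed.

Lemma pi_bracket x y : quot_bracket (q x) (q y) = q ⁅x, y⁆.
Proof.
rewrite /quot_bracket; have [[m mI ->] [k kI ->]] := (repr_rquot x, repr_rquot y); apply/rquotP.
rewrite bracketDl bracketDr -[_ + _ + _]addrA [X in X \in _]addrC addKr rpredD //.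
  exact: rideal_bracket.
exact: rideal_bracketl.
Qed.

Lemma adcoef_rideal x m k j : m \in I -> adcoef x m k.+1 j \in I.
Proof.
move=> mI; elim: k j => [|k IH] j; last first.
  rewrite /= rpredD ?rideal_bracket //; last exact: IH.
  by case: j => [|j]; [exact: rpred0 | apply/rideal_bracket/IH].
case: j => [|[|j]] /=; rewrite ?bracket0r ?bracketxx ?addr0 ?add0r ?rpred0 //.
exact: rideal_bracketl.
Qed.

Lemma pi_rpow x : quot_rpow (q x) = q x^[p].
Proof.
rewrite /quot_rpow; have [m mI ->] := repr_rquot x; apply/rquotP.
rewrite rpowD -[_ + _ + _]addrA [X in X \in _]addrC addKr rpredD ?rideal_rpow //.
rewrite big_nat rpred_sum // => i /andP[i_gt0 lt_ip]; apply: rpredZ.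
have /prednK <- : (0 < p.-1)%N by rewrite ltn_predRL (leq_ltn_trans i_gt0).
exact: adcoef_rideal.
Qed.

Lemma rquot_ind (P : rquot -> Prop) : (forall x, P (q x)) -> forall u, P u.
Proof. by move=> Pq u; rewrite -[u]rquot_reprK. Qed.

Fact quot_scalerA a b u : quot_scale a (quot_scale b u) = quot_scale (a * b) u.
Proof. by elim/rquot_ind: u => x; rewrite !pi_scale scalerA. Qed.
Fact quot_scale1r : left_id 1 quot_scale.
Proof. by elim/rquot_ind=> x; rewrite pi_scale scale1r. Qed.
Fact quot_scalerDr : right_distributive quot_scale +%R.
Proof.
move=> a; elim/rquot_ind=> x; elim/rquot_ind=> y.
by rewrite -rquotD !pi_scale scalerDr rquotD.
Qed.
Fact quot_scalerDl u : {morph quot_scale^~ u : a b / a + b}.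
Proof.
by move=> a b; elim/rquot_ind: u => x; rewrite !pi_scale scalerDl rquotD.
Qed.

HB.instance Definition _ := GRing.Zmodule_isLmodule.Build F rquot
  quot_scalerA quot_scale1r quot_scalerDr quot_scalerDl.

Lemma rquotZ a x : q (a *: x) = a *: q x.
Proof. by rewrite -pi_scale. Qed.

Lemma rquot0 : q 0 = 0.
Proof. by have := rquotZ 0 0; rewrite !scale0r. Qed.

Fact quot_bracketDl u v w :
  quot_bracket (u + v) w = quot_bracket u w + quot_bracket v w.
Proof.
elim/rquot_ind: u => x; elim/rquot_ind: v => y; elim/rquot_ind: w => z.
by rewrite -rquotD !pi_bracket bracketDl rquotD.
Qed.
Fact quot_bracketDr u v w :
  quot_bracket u (v + w) = quot_bracket u v + quot_bracket u w.
Proof.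
elim/rquot_ind: u => x; elim/rquot_ind: v => y; elim/rquot_ind: w => z.
by rewrite -rquotD !pi_bracket bracketDr rquotD.
Qed.
Fact quot_bracketZl a u v : quot_bracket (a *: u) v = a *: quot_bracket u v.
Proof.
elim/rquot_ind: u => x; elim/rquot_ind: v => y.
by rewrite -rquotZ !pi_bracket bracketZl rquotZ.
Qed.
Fact quot_bracketZr a u v : quot_bracket u (a *: v) = a *: quot_bracket u v.
Proof.
elim/rquot_ind: u => x; elim/rquot_ind: v => y.
by rewrite -rquotZ !pi_bracket bracketZr rquotZ.
Qed.
Fact quot_bracketxx u : quot_bracket u u = 0.
Proof. by elim/rquot_ind: u => x; rewrite pi_bracket bracketxx rquot0. Qed.
Fact quot_bracket_jacobi u v w :
  quot_bracket u (quot_bracket v w) + quot_bracket v (quot_bracket w u)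
    + quot_bracket w (quot_bracket u v) = 0.
Proof.
elim/rquot_ind: u => x; elim/rquot_ind: v => y; elim/rquot_ind: w => z.
by rewrite !pi_bracket -!rquotD bracket_jacobi rquot0.
Qed.

HB.instance Definition _ := Lmodule_isLie.Build F rquot
  quot_bracketDl quot_bracketDr quot_bracketZl quot_bracketZr
  quot_bracketxx quot_bracket_jacobi.

Lemma rquot_bracket x y : q ⁅x, y⁆ = ⁅q x, q y⁆.
Proof. by rewrite -pi_bracket. Qed.

Lemma rquot_adcoef x y k j : q (adcoef x y k j) = adcoef (q x) (q y) k j.
Proof.
elim: k j => [|k IH] [|j] //=; rewrite ?rquot0 //.
  by rewrite !add0r rquot_bracket IH.
by rewrite rquotD !rquot_bracket !IH.
Qed.

Fact quot_rpowZ a u : quot_rpow (a *: u) = a ^+ p *: quot_rpow u.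
Proof. by elim/rquot_ind: u => x; rewrite -rquotZ !pi_rpow rpowZ rquotZ. Qed.
Fact quot_bracket_rpow u v : ⁅quot_rpow u, v⁆ = iter p (bracket u) v.
Proof.
elim/rquot_ind: u => x; elim/rquot_ind: v => y.
rewrite pi_rpow -rquot_bracket bracket_rpow.
have iterE n : q (iter n (bracket x) y) = iter n (bracket (q x)) (q y).
  by elim: n => //= n <-; rewrite rquot_bracket.
exact: iterE.
Qed.
Fact quot_rpowD u v : quot_rpow (u + v) =
  quot_rpow u + quot_rpow v + \sum_(1 <= i < p) jacobson_s p u v i.
Proof.
elim/rquot_ind: u => x; elim/rquot_ind: v => y.
rewrite -rquotD !pi_rpow rpowD !rquotD; congr (_ + _).
rewrite (big_morph q rquotD rquot0).
by apply: eq_bigr => i _; rewrite rquotZ rquot_adcoef.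
Qed.

HB.instance Definition _ := Lie_isRestricted.Build p F rquot
  quot_rpowZ quot_bracket_rpow quot_rpowD.

Lemma rquot_pi_hom : rlie_hom q.
Proof.
split=> [a x y|x y|x]; first by rewrite rquotD rquotZ.
  exact: rquot_bracket.
by rewrite -pi_rpow.
Qed.

End QuotientAlgebra.

Definition rlie_presented (p : nat) (F : fieldType) (n m : nat)
    (G : rlieType p F) : Prop :=
  exists (L : rlieType p F) (x : 'I_n -> L) (w : 'I_m -> L),
    rlie_free_on x /\ rlie_isom G (rquot (rideal_gen w)).

(* In characteristic p, perfect means that x |-> x ^+ p is onto. *)
Definition perfect_pchar (p : nat) (F : fieldType) : Prop :=
  p \in [pchar F] /\ forall a : F, exists b : F, b ^+ p = a.

(* Main.v *)
Require Import Defs.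
From HB Require Import structures.
From mathcomp Require Import all_boot all_order all_algebra.
From mathcomp Require Import boolp functions.

Set Implicit Arguments.
Unset Strict Implicit.
Unset Printing Implicit Defensive.

Import GRing.Theory.
Local Open Scope ring_scope.
Local Open Scope lie_scope.

(** Write G = L / (W) with L free of rank n and W a set of m <= n - 2 words,
and let R be the set of p-polynomials in one variable, the restricted Lie
algebra freely generated by one element.  The theorem rests on four ideas.

  - G maps onto R.  The maximal abelian quotient of L is R^n, on which R acts as
    a skew polynomial ring.  When F is perfect this ring has a Euclidean
    division on both sides, so m words leave at least one coordinate free: after
    elementary changes of generators some homomorphism rho : L -> R sends one
    generator x_0 to 1, the other ones to 0, and kills W (dual_frame_kill).  Since m <= n - 2, besides x_0 there are still n - 1 > m
    generators to play with.

  - A cyclic algebra A is a quotient R / R f with f monic of degree d >= dim A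
    (cyclic_generator), so that G -> R -> A is onto.  Its kernel is M.

  - Homomorphisms from M to an algebra H come from homomorphisms from L to a
    wreath product.  Let J be the space of sequences in H (jets), with the
    bracket for which the shift is a derivation; R acts on J through the powers
    of the shift, and E = R x J is the semidirect product (wreath).  If
    Phi : L -> E kills W and lands in the part of E where f acts as 0, then
    reading the 0-th term of the sequence is a homomorphism M -> H
    (kernel_value_hom).

  - For large d there is room for a suitable Phi (wreath_hom_exists).  Let H be
    free on y and z, and q = p ^ d.  Send x_0 to (1, g_0), where g_0 starts
    with q - 1 zeros followed by y, and every other x_i to (0, s_i z) for a
    scalar sequence s_i that starts with sufficiently many zeros; all sequences
    satisfy the linear recurrence of order q given by f.  Because of the zeros,
    brackets and p-th powers inside J never contribute to Phi(w) for w in W, so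
    Phi(w) depends linearly on the s_i (linear_part).  Killing W then
    costs m q equations on about (n - 1) q unknowns, and as m < n - 1 there is a
    nonzero solution once q is large (residue_system).  Finally f(x_0) lies in
    M and has value y, while some (ad x_0)^k x_i lies in M and has value a
    nonzero multiple of z; so M maps onto H.

What remains is that J and E are restricted.  The p-map of J is dictated by its
0-th term and by the rule that the shift maps u^[p] to (ad u)^(p-1) (shift u);
its axioms follow by induction on the index from the formula for a derivation
applied to Jacobson's sum (derivation_jacobson_sum).  That formula holds in
every Lie algebra T because T acts on T + F by affine operators, where it is
Jacobson's formula for an associative algebra.  On E the p-map is
r^[p] + u^[p] + (Jacobson's sum of r and u), and its additivity is a four-term
identity between Jacobson sums (jacobson_sum_four), valid in every Lie algebra:
along a line of jets both sides have the same shift, so the polynomial that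
describes their difference is constant. *)

(** * Jacobson's formula in associative algebras *)
Section CharP.
Variables (p : nat) (S : nzRingType).
Hypothesis pS : p \in [pchar S].
Implicit Types x c : S.

Lemma bin_pchar_pred i : (i < p)%N -> 'C(p.-1, i)%:R = (-1) ^+ i :> S.
Proof.
have pr_p := pcharf_prime pS; elim: i => [|i IH] lt_ip; first by rewrite bin0.
have := prime_dvd_bin (k := i.+1) pr_p; rewrite lt_ip => /(_ isT) dv.
have := dvdn_pcharf pS 'C(p, i.+1); rewrite dv.
rewrite -[X in 'C(X, _)](prednK (prime_gt0 pr_p)) binS natrD IH ?(ltnW lt_ip) //.
by move=> /esym; rewrite addr_eq0 => /eqP ->; rewrite exprS mulN1r.
Qed.

Lemma iter_commutator n x c : iter n (fun d => x * d - d * x) c =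
  \sum_(i < n.+1) ((-1) ^+ i * (x ^+ (n - i) * c * x ^+ i)) *+ 'C(n, i).
Proof.
pose t n i := (-1) ^+ i * (x ^+ (n - i) * c * x ^+ i).
rewrite -/(t n _); elim: n => [|n IH] /=.
  by rewrite big_ord_recl big_ord0 /t !mul1r mulr1 addr0.
have tl i : (i <= n)%N -> x * t n i = t n.+1 i.
  by move=> le_in; rewrite /t mulrA commr_sign subSn // exprS !mulrA.
have tr i : t n i * x = - t n.+1 i.+1.
  by rewrite /t subSS exprS mulN1r mulNr opprK exprSr !mulrA.
rewrite {}IH mulr_sumr mulr_suml -sumrN [in RHS]big_ord_recl /= bin0.
under [in RHS]eq_bigr => i _ do rewrite /bump /= add1n binS mulrnDr.
rewrite big_split /= addrA; congr (_ + _); last first.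
  by apply: eq_bigr => i _; rewrite mulrnAl tr mulNrn opprK.
rewrite big_ord_recl /= bin0 mulrnAr tl //; congr (_ + _).
rewrite [in RHS]big_ord_recr /= bin_small // mulr0n addr0.
by apply: eq_bigr => i _; rewrite /bump /= add1n mulrnAr tl.
Qed.

(** In characteristic p the binomial coefficients of p - 1 are alternating signs,
so all the terms of (ad x)^(p-1) c get the coefficient 1. *)
Lemma iter_commutator_pred x c : iter p.-1 (fun d => x * d - d * x) c =
  \sum_(i < p) x ^+ (p.-1 - i) * c * x ^+ i.
Proof.
have p_gt0 := prime_gt0 (pcharf_prime pS).
rewrite iter_commutator prednK //; apply: eq_bigr => i _.
by rewrite -mulr_natl bin_pchar_pred // mulrA -exprD -signr_odd addnn odd_double mul1r.
Qed.

(** The sum for (ad x)^(p-1) c telescopes under one more commutator with x. *)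
Lemma iter_commutator_pchar x c :
  iter p (fun d => x * d - d * x) c = x ^+ p * c - c * x ^+ p.
Proof.
have p_gt0 := prime_gt0 (pcharf_prime pS).
rewrite -{1}(prednK p_gt0) iterS iter_commutator_pred.
pose g i := x ^+ (p - i) * c * x ^+ i.
have -> : x ^+ p * c - c * x ^+ p = - (g p - g 0%N).
  by rewrite /g subnn subn0 !expr0 mulr1 mul1r opprB.
rewrite -(telescope_sumr g (leq0n p)) big_mkord mulr_sumr mulr_suml -!sumrB -sumrN.
apply: eq_bigr => i _; have -> : (p.-1 - i = p - i.+1)%N.
  by rewrite subnS -!subn1 subnAC.
by rewrite opprB /g !mulrA -exprS subnSK // -[X in _ - X]mulrA -exprSr.
Qed.
End CharP.

Section Jacobson.
Variables (p : nat) (F : fieldType).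
Hypothesis pF : p \in [pchar F].
Variable Q : algType F.
Implicit Types a b : Q.

(** The proof that F has characteristic p is an argument of the type because the
restricted structure depends on it. *)
Definition commutator_lie of p \in [pchar F] : Type := Q.
Local Notation CL := (commutator_lie pF).

HB.instance Definition _ := GRing.Lmodule.on CL.

Definition commutator (a b : CL) : CL := (a : Q) * b - (b : Q) * a.

Fact commutatorDl a b c : commutator (a + b) c = commutator a c + commutator b c.
Proof. by rewrite /commutator mulrDl mulrDr opprD addrACA. Qed.
Fact commutatorDr a b c : commutator a (b + c) = commutator a b + commutator a c.
Proof. by rewrite /commutator mulrDl mulrDr opprD addrACA. Qed.
Fact commutatorZl k a b : commutator (k *: a) b = k *: commutator a b.
Proof. by rewrite /commutator scalerBr scalerAl scalerAr. Qed.
Fact commutatorZr k a b : commutator a (k *: b) = k *: commutator a b.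
Proof. by rewrite /commutator scalerBr scalerAr scalerAl. Qed.
Fact commutatorxx a : commutator a a = 0.
Proof. by rewrite /commutator subrr. Qed.
Fact commutator_jacobi a b c :
  commutator a (commutator b c) + commutator b (commutator c a)
    + commutator c (commutator a b) = 0.
Proof.
rewrite /commutator !mulrBl !mulrBr !mulrA !opprB !addrA.
rewrite [LHS](ACl ((1*12)*(2*7)*(3*10)*(4*5)*(6*11)*(8*9))%AC) /=.
by rewrite !(addrN, addNr) !addr0.
Qed.
HB.instance Definition _ := Lmodule_isLie.Build F CL commutatorDl commutatorDr
  commutatorZl commutatorZr commutatorxx commutator_jacobi.

Definition commutator_rpow (a : CL) : CL := (a : Q) ^+ p.

Lemma pchar_alg : p \in [pchar Q].
Proof. exact: (rmorph_pchar (in_alg Q)). Qed.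

Lemma pchar_poly_alg : p \in [pchar {poly Q}].
Proof. exact: (rmorph_pchar (@polyC Q) pchar_alg). Qed.

(** The link between the recursion that defines [adcoef] and a polynomial to
which formal derivation and evaluation apply. *)
Lemma coef_poly_iter_commutator (a b : Q) k j :
  (iter k (fun d => (a%:P * 'X + b%:P) * d - d * (a%:P * 'X + b%:P)) a%:P)`_j
    = adcoef (a : CL) b k j.
Proof.
elim: k j => [|k IH] j; first by rewrite /= coefC; case: j.
rewrite iterS; set q := iter _ _ _ in IH *.
rewrite coefB mulrDl mulrDr !coefD coefCM coefMC -mulrA -commr_polyX !mulrA.
rewrite !coefMX coefCM coefMC /= -!IH.
case: j => [|j] /=; first by rewrite !add0r.
by rewrite opprD addrACA -!IH.
Qed.

(** The terms between a^p and b^p are the middle coefficients of (a 'X + b)^p.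
The derivative of this polynomial is the sum of the
(a 'X + b)^(p-1-i) a (a 'X + b)^i, that is (ad (a 'X + b))^(p-1) a, whose
coefficients are known; evaluate at 'X = 1. *)
Lemma jacobson_formula (a b : Q) :
  (a + b) ^+ p = a ^+ p + b ^+ p + \sum_(1 <= i < p) jacobson_s p (a : CL) b i.
Proof.
have pr_p := pcharf_prime pF; have p_gt0 := prime_gt0 pr_p.
pose X := a%:P * 'X + b%:P : {poly Q}.
have coefXn n : [/\ (size (X ^+ n) <= n.+1)%N, (X ^+ n)`_0 = b ^+ n & (X ^+ n)`_n = a ^+ n].
  elim: n => [|n [IHs IH0 IHn]]; first by rewrite expr0 size_poly1 coefC.
  have sX : (size X <= 2)%N.
    rewrite (leq_trans (size_polyD _ _)) // geq_max.
    rewrite (leq_trans (size_polyMleq _ _)) ?size_polyX ?addn2 //= size_polyC.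
      by case: (_ == _).
    by case: (_ == _).
  have coefS j : (X ^+ n.+1)`_j =
      (if j is j'.+1 then a * (X ^+ n)`_j' else 0) + b * (X ^+ n)`_j.
    by rewrite exprS mulrDl coefD -mulrA -commr_polyX mulrA coefMX !coefCM; case: j.
  split.
  - rewrite exprS (leq_trans (size_polyMleq _ _)) //.
    by rewrite -subn1 leq_subLR (leq_trans (leq_add sX IHs)).
  - by rewrite coefS IH0 add0r exprS.
  - by rewrite coefS IHn (nth_default 0 IHs) mulr0 addr0 exprS.
have [sz c0 cp] := coefXn p.
have comX : comm_poly X 1 by rewrite /comm_poly mulr1 mul1r.
have -> : (a + b) ^+ p = (X ^+ p).[1].
  by rewrite horner_exp_comm // hornerD hornerCM hornerX hornerC mulr1.
rewrite (horner_coef_wide _ sz) (eq_bigr (fun i : 'I__ => (X ^+ p)`_i)); last first.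
  by move=> i _; rewrite expr1n mulr1.
rewrite -(big_mkord xpredT (fun i => (X ^+ p)`_i)) big_nat_recr //= big_ltn // c0 cp.
rewrite addrC addrA; congr (_ + _).
apply: eq_big_nat => i /andP[i_gt0 lt_ip].
have i_neq0 : i%:R != 0 :> F by rewrite -(dvdn_pcharf pF) gtnNdvd.
rewrite /jacobson_s -coef_poly_iter_commutator -/X.
apply: (scalerI i_neq0); rewrite scalerA divff // scale1r.
rewrite (iter_commutator_pred pchar_poly_alg).
have derivXn n : (X ^+ n)^`() = \sum_(j < n) X ^+ (n.-1 - j) * a%:P * X ^+ j.
  elim: n => [|n IH]; first by rewrite expr0 derivC big_ord0.
  rewrite exprS derivM IH big_ord_recr /= subnn expr0 mul1r addrC mulr_sumr.
  congr (_ + _); first by rewrite /X derivD derivM !derivC derivX mul0r add0r mulr1 addr0.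
  apply: eq_bigr => j _; rewrite !mulrA -exprS.
  by rewrite -subn1 subnAC subn1 prednK // subn_gt0.
by rewrite -derivXn coef_deriv prednK // scaler_nat.
Qed.

Fact commutator_rpowZ k (a : CL) :
  commutator_rpow (k *: a) = k ^+ p *: commutator_rpow a.
Proof. exact: exprZn. Qed.
Fact commutator_bracket_rpow (a b : CL) :
  ⁅commutator_rpow a, b⁆ = iter p (bracket a) b.
Proof. exact: (esym (iter_commutator_pchar pchar_alg _ _)). Qed.

HB.instance Definition _ := Lie_isRestricted.Build p F CL
  commutator_rpowZ commutator_bracket_rpow jacobson_formula.

End Jacobson.

(** * Affine operators on a vector space *)
Section AffineEndo.
Variables (F : fieldType) (T : lmodType F).
Local Notation W := (T * F^o)%type.

(** Endomorphisms of T + F rather than of T: the extra coordinate makes room for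
a derivation of T next to its inner derivations, and makes the ring nonzero
even if T is zero. *)
Record affine_endo := AffineEndo { affine_fun :> W -> W; affine_linear : linear affine_fun }.

HB.instance Definition _ := gen_eqMixin affine_endo.
HB.instance Definition _ := gen_choiceMixin affine_endo.

HB.instance Definition _ (f : affine_endo) :=
  GRing.isLinear.Build F W W *:%R f (affine_linear f).

Lemma affine_endoP (f g : affine_endo) : f =1 g -> f = g.
Proof.
case: f g => [f lf] [g lg] /= /funext eq_fg.
by case: _ / eq_fg in lg *; congr AffineEndo; exact: Prop_irrelevance.
Qed.

Implicit Types f g h : affine_endo.

Fact affine_zero_linear : linear (fun _ : W => 0 : W).
Proof. by move=> a x y; rewrite scaler0 addr0. Qed.
Fact affine_one_linear : linear (fun w : W => w).
Proof. by []. Qed.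
Fact affine_add_linear f g : linear (fun w => f w + g w).
Proof. by move=> a x y; rewrite !affine_linear scalerDr addrACA. Qed.
Fact affine_opp_linear f : linear (fun w => - f w).
Proof. by move=> a x y; rewrite !affine_linear opprD scalerN. Qed.
Fact affine_mul_linear f g : linear (fun w => f (g w)).
Proof. by move=> a x y; rewrite !affine_linear. Qed.
Fact affine_scale_linear (a : F) f : linear (fun w => a *: f w).
Proof. by move=> b x y; rewrite !affine_linear scalerDr !scalerA mulrC. Qed.

Definition affine_zero := AffineEndo affine_zero_linear.
Definition affine_one := AffineEndo affine_one_linear.
Definition affine_add f g := AffineEndo (affine_add_linear f g).
Definition affine_opp f := AffineEndo (affine_opp_linear f).
Definition affine_mul f g := AffineEndo (affine_mul_linear f g).
Definition affine_scale a f := AffineEndo (affine_scale_linear a f).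

Fact affine_addA : associative affine_add.
Proof. by move=> f g h; apply: affine_endoP => w; exact: addrA. Qed.
Fact affine_addC : commutative affine_add.
Proof. by move=> f g; apply: affine_endoP => w; exact: addrC. Qed.
Fact affine_add0 : left_id affine_zero affine_add.
Proof. by move=> f; apply: affine_endoP => w; exact: add0r. Qed.
Fact affine_addN : left_inverse affine_zero affine_opp affine_add.
Proof. by move=> f; apply: affine_endoP => w; exact: addNr. Qed.
HB.instance Definition _ := GRing.isZmodule.Build affine_endo
  affine_addA affine_addC affine_add0 affine_addN.

Fact affine_mulA : associative affine_mul.
Proof. by move=> f g h; apply: affine_endoP. Qed.
Fact affine_mul1 : left_id affine_one affine_mul.
Proof. by move=> f; apply: affine_endoP. Qed.
Fact affine_mulr1 : right_id affine_one affine_mul.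
Proof. by move=> f; apply: affine_endoP. Qed.
Fact affine_mulDl : left_distributive affine_mul affine_add.
Proof. by move=> f g h; apply: affine_endoP. Qed.
Fact affine_mulDr : right_distributive affine_mul affine_add.
Proof. by move=> f g h; apply: affine_endoP => w /=; rewrite raddfD. Qed.
Fact affine_one_neq0 : affine_one != 0.
Proof.
apply/eqP => /(congr1 (fun f : affine_endo => (f (0, 1)).2)) /= /eqP.
by rewrite oner_eq0.
Qed.
HB.instance Definition _ := GRing.Zmodule_isNzRing.Build affine_endo
  affine_mulA affine_mul1 affine_mulr1 affine_mulDl affine_mulDr affine_one_neq0.

Fact affine_scaleA a b f : affine_scale a (affine_scale b f) = affine_scale (a * b) f.
Proof. by apply: affine_endoP => w /=; rewrite scalerA. Qed.
Fact affine_scale1 : left_id 1 affine_scale.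
Proof. by move=> f; apply: affine_endoP => w /=; rewrite scale1r. Qed.
Fact affine_scaleDr : right_distributive affine_scale +%R.
Proof. by move=> a f g; apply: affine_endoP => w /=; rewrite scalerDr. Qed.
Fact affine_scaleDl f : {morph affine_scale^~ f : a b / a + b}.
Proof. by move=> a b; apply: affine_endoP => w /=; rewrite scalerDl. Qed.
HB.instance Definition _ := GRing.Zmodule_isLmodule.Build F affine_endo
  affine_scaleA affine_scale1 affine_scaleDr affine_scaleDl.

Fact affine_scaleAl (a : F) f g : a *: (f * g) = a *: f * g.
Proof. by apply: affine_endoP. Qed.
HB.instance Definition _ := GRing.Lmodule_isLalgebra.Build F affine_endo affine_scaleAl.
Fact affine_scaleAr (a : F) f g : a *: (f * g) = f * (a *: g).
Proof.
by apply: affine_endoP => w /=; rewrite linearZ.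
Qed.
HB.instance Definition _ := GRing.Lalgebra_isAlgebra.Build F affine_endo affine_scaleAr.

Lemma affine_expE f n w : (f ^+ n) w = iter n f w.
Proof. by elim: n => //= n <-; rewrite exprS. Qed.
End AffineEndo.

(** * Derivations and Jacobson's sum in Lie algebras *)

(** The correction term in the p-th power of x + y. *)
Definition jacobson_sum (p : nat) (F : fieldType) (T : lieType F) (x y : T) : T :=
  \sum_(1 <= i < p) jacobson_s p x y i.

Record lie_hom (F : fieldType) (T U : lieType F) (f : T -> U) : Prop := LieHom {
  lie_hom_linear : linear f;
  lie_hom_bracket : forall x y, f ⁅x, y⁆ = ⁅f x, f y⁆
}.

Record lie_derivation (F : fieldType) (T : lieType F) (d : T -> T) : Prop := LieDerivation {
  derivation_linear : linear d;
  derivation_bracket : forall x y, d ⁅x, y⁆ = ⁅d x, y⁆ + ⁅x, d y⁆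
}.

(** Homomorphisms are plain functions with a proof of linearity, so the usual
consequences of linearity are stated in this form. *)
Section LinearFacts.
Variables (F : fieldType) (U V : lmodType F) (f : U -> V).
Hypothesis lf : linear f.
Lemma lin0 : f 0 = 0.
Proof. by have /eqP := lf 1 0 0; rewrite scaler0 scale1r add0r -subr_eq subrr => /eqP. Qed.
Lemma linD x y : f (x + y) = f x + f y.
Proof. by have := lf 1 x y; rewrite !scale1r. Qed.
Lemma linZ a x : f (a *: x) = a *: f x.
Proof. by have := lf a x 0; rewrite lin0 !addr0. Qed.
Lemma linN x : f (- x) = - f x.
Proof. by rewrite -scaleN1r linZ scaleN1r. Qed.
Lemma linB x y : f (x - y) = f x - f y.
Proof. by rewrite linD linN. Qed.
Lemma lin_sum I r (P : pred I) (E : I -> U) :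
  f (\sum_(i <- r | P i) E i) = \sum_(i <- r | P i) f (E i).
Proof. exact: (big_morph f linD lin0). Qed.
End LinearFacts.

Section LieBasics.
Variables (F : fieldType) (T : lieType F).
Implicit Types x y z : T.

Lemma bracket_linear x : linear (bracket x).
Proof. by move=> a y z; rewrite bracketDr bracketZr. Qed.
Lemma bracket_linearl y : linear (fun x => ⁅x, y⁆).
Proof. by move=> a x z; rewrite bracketDl bracketZl. Qed.
Lemma bracket0l x : ⁅0, x⁆ = 0.
Proof. exact: (lin0 (bracket_linearl x)). Qed.
Lemma bracketNr x y : ⁅x, - y⁆ = - ⁅x, y⁆.
Proof. exact: (linN (bracket_linear x)). Qed.
Lemma bracket_bracket x y z : ⁅⁅x, y⁆, z⁆ = ⁅x, ⁅y, z⁆⁆ - ⁅y, ⁅x, z⁆⁆.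
Proof.
have /eqP := bracket_jacobi x y z.
rewrite [⁅z, ⁅x, y⁆⁆]bracketC subr_eq0 => /eqP <-.
by rewrite [⁅z, x⁆]bracketC bracketNr.
Qed.
Lemma iter_bracket_linear n x : linear (iter n (bracket x)).
Proof. by move=> a y z; elim: n => //= n ->; rewrite bracketDr bracketZr. Qed.

Lemma adcoef_scale a x y k j : adcoef (a *: x) (a *: y) k j = a ^+ k.+1 *: adcoef x y k j.
Proof.
elim: k j => [|k IH] j; first by case: j => [|j] /=; rewrite ?scaler0.
case: j => [|j]; rewrite /= !IH !bracketZl !bracketZr !scalerA -!exprS ?add0r //.
by rewrite scalerDr.
Qed.
Lemma jacobson_sum_scale p a x y : (1 < p)%N ->
  jacobson_sum p (a *: x) (a *: y) = a ^+ p *: jacobson_sum p x y.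
Proof.
move=> p_gt1; rewrite /jacobson_sum scaler_sumr; apply: eq_bigr => i _.
by rewrite /jacobson_s adcoef_scale prednK ?(ltnW p_gt1) // !scalerA mulrC.
Qed.

Lemma adcoefS x y k j : adcoef x y k.+1 j =
  (if j is j'.+1 then ⁅x, adcoef x y k j'⁆ else 0) + ⁅y, adcoef x y k j⁆.
Proof. by []. Qed.

Lemma adcoef0r x k j : (0 < k)%N -> adcoef x 0 k j = 0.
Proof.
case: k => // k _; elim: k j => [|k IH] j.
  by case: j => [|[|j]] /=; rewrite bracket0l ?bracketxx ?bracket0r ?addr0.
by rewrite adcoefS bracket0l; case: j => [|j]; rewrite ?IH ?bracket0r addr0.
Qed.
Lemma jacobson_sum0r p x : (1 < p)%N -> jacobson_sum p x 0 = 0.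
Proof.
move=> p_gt1; apply: big1 => i _; rewrite /jacobson_s adcoef0r ?scaler0 //.
by rewrite -ltnS prednK // ltnW.
Qed.
Lemma adcoef0l y k j : adcoef 0 y k j = 0.
Proof.
elim: k j => [|k IH] j; first by case: j.
by case: j => [|j]; rewrite /= !IH ?bracket0r ?bracket0l ?addr0.
Qed.
Lemma jacobson_sum0l p y : jacobson_sum p 0 y = 0.
Proof. by apply: big1 => i _; rewrite /jacobson_s adcoef0l scaler0. Qed.

Lemma adcoef_commuting x y k j : ⁅x, y⁆ = 0 -> (0 < k)%N -> adcoef x y k j = 0.
Proof.
move=> xy0; case: k => // k _; elim: k j => [|k IH] j.
  by case: j => [|[|j]] /=; rewrite ?(bracketC y x) ?xy0 ?bracketxx ?bracket0r ?oppr0 ?addr0.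
by rewrite adcoefS !IH !bracket0r; case: j => [|j]; rewrite ?IH ?bracket0r addr0.
Qed.
Lemma jacobson_sum_commuting p x y : (1 < p)%N -> ⁅x, y⁆ = 0 -> jacobson_sum p x y = 0.
Proof.
move=> p_gt1 xy0; apply: big1 => i _; rewrite /jacobson_s adcoef_commuting ?scaler0 //.
by rewrite -ltnS prednK // ltnW.
Qed.
End LieBasics.

Section LieHomFacts.
Variables (F : fieldType) (T U : lieType F) (f : T -> U).
Hypothesis hf : lie_hom f.
Let lf := lie_hom_linear hf.
Lemma lie_hom_iter x n y : f (iter n (bracket x) y) = iter n (bracket (f x)) (f y).
Proof. by elim: n => //= n <-; rewrite (lie_hom_bracket hf). Qed.
Lemma lie_hom_adcoef x y k j : f (adcoef x y k j) = adcoef (f x) (f y) k j.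
Proof.
elim: k j => [|k IH] j; first by case: j => [|j] //=; rewrite (lin0 lf).
rewrite !adcoefS (linD lf) !(lie_hom_bracket hf) IH.
by case: j => [|j]; rewrite ?(lin0 lf) ?(lie_hom_bracket hf) ?IH.
Qed.
Lemma lie_hom_jacobson_sum p x y : f (jacobson_sum p x y) = jacobson_sum p (f x) (f y).
Proof.
by rewrite /jacobson_sum (lin_sum lf); apply: eq_bigr => i _; rewrite (linZ lf) lie_hom_adcoef.
Qed.
End LieHomFacts.

Section JacobsonInLie.
Variables (p : nat) (F : fieldType).
Hypothesis pF : p \in [pchar F].
Variable T : lieType F.
Implicit Types x y u v : T.
Local Notation W := (T * F^o)%type.
Local Notation Q := (affine_endo T).
Local Notation CL := (commutator_lie Q pF).

(** The value at u^[p] of a derivation d that is compatible with the p-map. *)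
Definition ad_pred (d : T -> T) u := iter p.-1 (bracket u) (d u).

Section Derivation.
Variable d : T -> T.
Hypothesis der : lie_derivation d.
Let ld := derivation_linear der.

(** In T extended by an element D acting as d, this operator is the adjoint action
of u on T + F D. *)
Fact derivation_op_linear u : linear (fun w : W => (⁅u, w.1⁆ - (w.2 : F) *: d u, 0) : W).
Proof.
move=> a x y /=; congr (_, _); last by rewrite /= scaler0 addr0.
rewrite /= bracketDr bracketZr scalerDl opprD scalerBr addrACA; congr (_ + _ + (_ - _)).
by rewrite scalerA.
Qed.
Definition derivation_op u : CL := AffineEndo (derivation_op_linear u).

Lemma derivation_op_hom : lie_hom derivation_op.
Proof.
split=> [a u v|u v]; apply: affine_endoP => -[x s].
  congr (_, _); last by rewrite /= scaler0 addr0.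
  by rewrite /= ld bracketDl bracketZl scalerDr scalerBr opprD addrACA !scalerA mulrC.
congr (_, _); last by rewrite /= subr0.
rewrite /= !scale0r !subr0 !bracketDr !bracketNr !bracketZr bracket_bracket (derivation_bracket der).
rewrite [⁅d u, v⁆]bracketC scalerDr scalerN !opprD !opprK !addrA.
by rewrite [RHS](ACl (1*3*4*2)%AC).
Qed.

Lemma derivation_op_iter u n x : iter n (derivation_op u : Q) (x, 0) = (iter n (bracket u) x, 0).
Proof. by elim: n => //= n ->; rewrite /= scale0r subr0. Qed.

Lemma derivation_op_exp u : ((derivation_op u : Q) ^+ p) (0, 1) = (- ad_pred d u, 0).
Proof.
have p_gt0 := prime_gt0 (pcharf_prime pF).
rewrite affine_expE -[in LHS](prednK p_gt0) iterSr /= bracket0r scale1r sub0r.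
by rewrite derivation_op_iter (linN (iter_bracket_linear _ _)).
Qed.

Lemma derivation_op_jacobson u v (w : W) :
  ((derivation_op (u + v) : Q) ^+ p) w = ((derivation_op u : Q) ^+ p) w
    + ((derivation_op v : Q) ^+ p) w + (derivation_op (jacobson_sum p u v) : Q) w.
Proof.
rewrite (lie_hom_jacobson_sum derivation_op_hom) (linD (lie_hom_linear derivation_op_hom)).
by rewrite [in LHS](jacobson_formula pF).
Qed.

(** Jacobson's formula for the operators attached to u and v, applied to the
element (0, 1) that stands for D: since [u, D] = - d u, the p-th power of
the operator of u sends D to - (ad u)^(p-1) (d u). *)
Lemma derivation_jacobson_sum u v :
  d (jacobson_sum p u v) = ad_pred d (u + v) - ad_pred d u - ad_pred d v.
Proof.
have /(congr1 (fun w : W => - w.1)) := derivation_op_jacobson u v (0, 1).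
rewrite !derivation_op_exp /= bracket0r scale1r sub0r !opprD !opprK => ->.
by rewrite -addrA -opprD addrC addKr.
Qed.

End Derivation.

Fact zero_derivation : lie_derivation (fun _ : T => 0).
Proof. by split=> [a x y|x y]; rewrite ?scaler0 ?addr0 // bracket0l bracket0r addr0. Qed.

Lemma bracket_jacobson_sum u v x : ⁅jacobson_sum p u v, x⁆ =
  iter p (bracket (u + v)) x - iter p (bracket u) x - iter p (bracket v) x.
Proof.
have /(congr1 (fun w : W => w.1)) := derivation_op_jacobson zero_derivation u v (x, 0).
rewrite !affine_expE !derivation_op_iter /= scale0r subr0 => ->.
by rewrite -addrA -opprD addrC addKr.
Qed.

Section Operators.
Variable d : T -> T.
Hypothesis der : lie_derivation d.
Let ld := derivation_linear der.

Fact fst_op_linear : linear (fun w : W => (d w.1, 0) : W).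
Proof. by move=> a x y /=; rewrite ld; congr (_, _); rewrite /= scaler0 addr0. Qed.
Let D : CL := AffineEndo fst_op_linear.
Let op : T -> CL := derivation_op (fun _ : T => 0).
Let op_hom : lie_hom op := derivation_op_hom zero_derivation.

Lemma commutator_der_op u : ⁅D, op u⁆ = op (d u).
Proof.
apply: affine_endoP => -[x s]; congr (_, _); last by rewrite /= subr0.
by rewrite /= !scaler0 !subr0 (derivation_bracket der) addrK.
Qed.

(** (ad D)^p = ad (D^p) in an associative algebra of characteristic p. *)
Lemma derivation_iter_pchar : lie_derivation (iter p d).
Proof.
split=> [a x y|u v]; first by elim: p => //= n ->; rewrite ld.
have /(congr1 (fun f : Q => (f (v, 0)).1)) := iter_commutator_pchar (pchar_alg pF Q) D (op u).
have -> : iter p (fun b : Q => (D : Q) * b - b * (D : Q)) (op u) = op (iter p d u).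
  by elim: p => //= n ->; exact: commutator_der_op.
rewrite /= !affine_expE.
have iterD n (w : W) : (iter n (D : Q) w).1 = iter n d w.1 by elim: n => //= n ->.
by rewrite !iterD /= !scaler0 !subr0 => ->; rewrite subrK.
Qed.

(** (ad a)^p D = a^p D - D a^p, where a and D are the operators ad u and d; moreover
(ad a) D is the operator - ad (d u). *)
Lemma derivation_iter_bracket u v :
  d (iter p (bracket u) v) = iter p (bracket u) (d v) + ⁅ad_pred d u, v⁆.
Proof.
have /(congr1 (fun f : Q => (f (v, 0)).1)) := iter_commutator_pchar (pchar_alg pF Q) (op u) D.
have -> : iter p (fun b : Q => (op u : Q) * b - b * (op u : Q)) D = - op (ad_pred d u).
  rewrite -[in LHS](prednK (prime_gt0 (pcharf_prime pF))) iterSr.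
  have -> : (op u : Q) * D - D * (op u : Q) = op (- d u).
    by rewrite (linN (lie_hom_linear op_hom)) -commutator_der_op -bracketC.
  by rewrite -(linN (lie_hom_linear op_hom)) /ad_pred -(linN (iter_bracket_linear _ _)) (lie_hom_iter op_hom).
rewrite /= !affine_expE !derivation_op_iter /= scaler0 subr0 => /eqP.
by rewrite eqr_oppLR opprB => /eqP ->; rewrite addrCA subrr addr0.
Qed.
End Operators.
End JacobsonInLie.

Lemma addr_subr2 (V : zmodType) (a b c : V) : b + c + (a - b - c) = a.
Proof. by rewrite -(addrA a) -opprD [LHS]addrC subrK. Qed.

(** * Jets *)
Section Jets.
Variables (F : fieldType) (T : lieType F).

(** Sequences in T, seen as formal power series with divided powers: u l is the
coefficient of t^l / l!, so that the shift is d/dt. *)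
Definition jets : Type := nat -> T.
HB.instance Definition _ := GRing.Lmodule.copy jets (nat -> T).

Implicit Types u v w : jets.

Definition shift u : jets := fun l => u l.+1.

(** The bracket is determined by its 0-th term and the Leibniz rule for the shift;
this recursion hides the binomial coefficients of divided powers. *)
Fixpoint jet_bracket_at (l : nat) u v : T :=
  if l is l'.+1 then jet_bracket_at l' (shift u) v + jet_bracket_at l' u (shift v)
  else ⁅u 0, v 0⁆.
Definition jet_bracket u v : jets := fun l => jet_bracket_at l u v.

Lemma jetD u v l : (u + v) l = u l + v l. Proof. by []. Qed.
Lemma jet0 l : (0 : jets) l = 0. Proof. by []. Qed.
Lemma jetN u l : (- u) l = - u l. Proof. by []. Qed.
Lemma jetZ a u l : (a *: u) l = a *: u l. Proof. by []. Qed.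
Lemma jet_sum I r (P : pred I) (f : I -> jets) l :
  (\sum_(i <- r | P i) f i) l = \sum_(i <- r | P i) f i l.
Proof. exact: (big_morph (fun u : jets => u l)). Qed.
Lemma jet_eqP u v : (forall l, u l = v l) -> u = v.
Proof. exact: funext. Qed.

Fact jet_bracketDl u v w : jet_bracket (u + v) w = jet_bracket u w + jet_bracket v w.
Proof.
apply: jet_eqP => l; rewrite jetD /jet_bracket; elim: l u v w => [|l IH] u v w /=.
  exact: bracketDl.
by rewrite (IH (shift u)) IH addrACA.
Qed.
Fact jet_bracketDr u v w : jet_bracket u (v + w) = jet_bracket u v + jet_bracket u w.
Proof.
apply: jet_eqP => l; rewrite jetD /jet_bracket; elim: l u v w => [|l IH] u v w /=.
  exact: bracketDr.
by rewrite IH (IH _ (shift v)) addrACA.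
Qed.
Fact jet_bracketZl a u v : jet_bracket (a *: u) v = a *: jet_bracket u v.
Proof.
apply: jet_eqP => l; rewrite jetZ /jet_bracket; elim: l u v => [|l IH] u v /=.
  exact: bracketZl.
by rewrite (IH (shift u)) IH scalerDr.
Qed.
Fact jet_bracketZr a u v : jet_bracket u (a *: v) = a *: jet_bracket u v.
Proof.
apply: jet_eqP => l; rewrite jetZ /jet_bracket; elim: l u v => [|l IH] u v /=.
  exact: bracketZr.
by rewrite (IH _ (shift v)) IH scalerDr.
Qed.
Lemma jet_bracketC u v : jet_bracket u v = - jet_bracket v u.
Proof.
apply: jet_eqP => l; rewrite jetN /jet_bracket; elim: l u v => [|l IH] u v /=.
  exact: bracketC.
by rewrite IH (IH u) opprD addrC.
Qed.
Fact jet_bracketxx u : jet_bracket u u = 0.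
Proof.
apply: jet_eqP; case=> [|l]; first exact: bracketxx.
by rewrite /jet_bracket /= -!/(jet_bracket _ _ l) jet_bracketC jetN addNr.
Qed.
Fact jet_bracket_jacobi u v w :
  jet_bracket u (jet_bracket v w) + jet_bracket v (jet_bracket w u)
    + jet_bracket w (jet_bracket u v) = 0.
Proof.
have shiftE x y : shift (jet_bracket x y) = jet_bracket (shift x) y + jet_bracket x (shift y).
  by [].
apply: jet_eqP => l; rewrite !jetD jet0; elim: l u v w => [|l IH] u v w.
  exact: bracket_jacobi.
rewrite -[_ l.+1]/(shift (jet_bracket u (jet_bracket v w)) l).
rewrite -[X in _ + X + _]/(shift (jet_bracket v (jet_bracket w u)) l).
rewrite -[X in _ + X]/(shift (jet_bracket w (jet_bracket u v)) l).
rewrite !shiftE !jet_bracketDr !jetD.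
rewrite !addrA [LHS](ACl ((1*6*8)*(2*4*9)*(3*5*7))%AC) /=.
by rewrite (IH (shift u) v w) (IH u (shift v) w) (IH u v (shift w)) !addr0.
Qed.
HB.instance Definition _ := Lmodule_isLie.Build F jets jet_bracketDl jet_bracketDr
  jet_bracketZl jet_bracketZr jet_bracketxx jet_bracket_jacobi.

Lemma shift_linear : linear shift.
Proof. by []. Qed.
Lemma shift_derivation : lie_derivation shift.
Proof. by []. Qed.
Lemma iter_shiftE n u l : iter n shift u l = u (l + n)%N.
Proof. by elim: n l => [|n IH] l; rewrite ?addn0 //= /shift IH addSnnS. Qed.

Lemma ev0_hom : lie_hom (fun u => u 0%N : T).
Proof. by []. Qed.

Lemma jet_bracketS u v l : ⁅u, v⁆ l.+1 = ⁅shift u, v⁆ l + ⁅u, shift v⁆ l.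
Proof. by []. Qed.

(** The l-th term of a bracket only combines terms whose indices add up to l. *)
Lemma jet_bracket_vanish a b u v l : (forall i, (i < a)%N -> u i = 0) ->
  (forall i, (i < b)%N -> v i = 0) -> (l < a + b)%N -> ⁅u, v⁆ l = 0.
Proof.
elim: l a b u v => [|l IH] a b u v ua vb lt_l.
  rewrite -[LHS]/(⁅u 0%N, v 0%N⁆); case: a => [|a] in ua lt_l *.
    by rewrite vb ?bracket0r.
  by rewrite ua ?bracket0l.
have -> : ⁅u, v⁆ l.+1 = ⁅shift u, v⁆ l + ⁅u, shift v⁆ l by [].
have shift0 c w : (forall i, (i < c)%N -> w i = 0) -> forall i, (i < c.-1)%N -> shift w i = 0.
  by move=> w0 i lt_ic; apply: w0; rewrite -ltn_predRL.
rewrite (IH a.-1 b _ _ (shift0 _ _ ua)) // ?(IH a b.-1 _ _ ua (shift0 _ _ vb)) ?addr0 //.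
  by case: b lt_l {vb} => [|b]; rewrite ?addnS ?addn0 // => /ltnW.
by case: a lt_l {ua} => [|a]; rewrite ?addSn ?add0n // => /ltnW.
Qed.

Lemma jet_bracket_commuting u v : (forall i j, ⁅u i, v j⁆ = 0) -> ⁅u, v⁆ = 0.
Proof.
move=> uv; apply: jet_eqP => l; elim: l u v uv => [|l IH] u v uv; first exact: uv.
by rewrite jet_bracketS !IH ?addr0 // => i j; exact: uv.
Qed.
End Jets.

Section RestrictedJets.
Variables (p : nat) (F : fieldType).
Hypothesis pF : p \in [pchar F].
Variable H : rlieType p F.
Local Notation J := (jets H).
Implicit Types u v : J.

Let p_gt1 : (1 < p)%N := prime_gt1 (pcharf_prime pF).
Let p_gt0 : (0 < p)%N := ltnW p_gt1.

Let p_pred : p.-1 = p.-2.+1.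
Proof. by case: p p_gt1 => [|[]]. Qed.

(** The only choice compatible with the 0-th term and with the shift. *)
Definition jet_rpow u : J := fun l =>
  if l is l'.+1 then ad_pred p (@shift F H) u l' else (u 0%N)^[p].

Lemma ad_pred_scale (T : lieType F) (d : T -> T) a (u : T) : linear d ->
  ad_pred p d (a *: u) = a ^+ p *: ad_pred p d u.
Proof.
move=> ld; rewrite /ad_pred (linZ ld) (linZ (iter_bracket_linear _ _)).
rewrite -[in RHS](prednK p_gt0) exprS -scalerA; congr (_ *: _).
by elim: p.-1 => [|k IH] /=; rewrite ?scale1r // IH bracketZl bracketZr scalerA exprS.
Qed.

Lemma jet_rpowZ a u : jet_rpow (a *: u) = a ^+ p *: jet_rpow u.
Proof.
apply: jet_eqP; case=> [|l]; first exact: rpowZ.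
by rewrite jetZ /= (ad_pred_scale _ _ (@shift_linear F H)).
Qed.

Lemma jet_rpowD u v : jet_rpow (u + v) = jet_rpow u + jet_rpow v + jacobson_sum p u v.
Proof.
apply: jet_eqP; case=> [|l].
  by rewrite !jetD (lie_hom_jacobson_sum (@ev0_hom F H)); exact: rpowD.
rewrite !jetD -[jacobson_sum p u v l.+1]/(shift (jacobson_sum p u v) l).
rewrite (derivation_jacobson_sum pF (@shift_derivation F H)).
exact/esym/addr_subr2.
Qed.

(** Both sides have the same 0-th term, and the shift replaces v by shift v in
their difference. *)
Lemma jet_bracket_rpow u v : ⁅jet_rpow u, v⁆ = iter p (bracket u) v.
Proof.
apply: jet_eqP => l; elim: l v => [|l IH] v.
  by rewrite (lie_hom_iter (@ev0_hom F H)); exact: bracket_rpow.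
rewrite jet_bracketS IH -[RHS]/(shift (iter p (bracket u) v) l).
by rewrite (derivation_iter_bracket pF (@shift_derivation F H)) addrC.
Qed.

Lemma derivation_iter_pcharX (T : lieType F) (d : T -> T) j :
  lie_derivation d -> lie_derivation (iter (p ^ j) d).
Proof.
move=> der; elim: j => [|j IH] //; rewrite expnS.
have -> : iter (p * p ^ j) d = iter p (iter (p ^ j) d).
  by apply/funext => x; elim: {1 3}p => // n IHn; rewrite mulSn iterD IHn.
exact: derivation_iter_pchar.
Qed.

Definition monomial_jet k (h : H) : J := fun l => if l == k then h else 0.

(** The defect of this identity is additive in u, by the derivation formula for
Jacobson's sum, and vanishes on sequences with a single nonzero term, where
every bracket is zero; since its l-th term depends only on finitely many terms of
u, it vanishes. *)
Lemma iter_shift_jet_rpow j u :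
  iter (p ^ j) (@shift F H) (jet_rpow u) = ad_pred p (iter (p ^ j) (@shift F H)) u.
Proof.
set d := iter (p ^ j) _.
have der : lie_derivation d by exact/derivation_iter_pcharX/shift_derivation.
have ld := derivation_linear der.
have dE w l : d w l = w (l + p ^ j)%N by exact: iter_shiftE.
pose om w := d (jet_rpow w) - ad_pred p d w.
have omD v w : om (v + w) = om v + om w.
  rewrite /om jet_rpowD !(linD ld) (derivation_jacobson_sum pF der).
  set A := ad_pred p d (v + w); set B := ad_pred p d v; set C := ad_pred p d w.
  rewrite -(addrA A) -opprD [_ + (A - _)]addrCA [A + _]addrC addrK.
  by rewrite opprD addrACA.
have om_mono k h : om (monomial_jet k h) = 0.
  set m := monomial_jet k h.
  have mm i i' : ⁅m i, m i'⁆ = 0.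
    by rewrite /m /monomial_jet; do 2!case: ifP => _; rewrite ?bracketxx ?bracket0l ?bracket0r.
  have ad0 n : ad_pred p (iter n (@shift F H)) m = 0.
    rewrite /ad_pred p_pred iterSr jet_bracket_commuting.
      by rewrite (lin0 (iter_bracket_linear _ _)).
    by move=> i i'; exact: etrans (congr1 (bracket _) (iter_shiftE _ _ _)) (mm _ _).
  rewrite /om ad0 subr0; apply: jet_eqP => l; rewrite dE.
  have: (0 < l + p ^ j)%N by rewrite addn_gt0 expn_gt0 p_gt0 orbT.
  by case: (l + p ^ j)%N => // l' _; rewrite /jet_rpow (ad0 1%N).
have om_vanish w l : (forall i, (i < (l + p ^ j).+1)%N -> w i = 0) -> om w l = 0.
  move=> w0; rewrite /om jetD jetN dE /ad_pred p_pred.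
  have: (0 < l + p ^ j)%N by rewrite addn_gt0 expn_gt0 p_gt0 orbT.
  rewrite iterS (@jet_bracket_vanish _ _ (l + p ^ j).+1 0) ?subr0 ?addn0 // ?ltnS ?leq_addr //.
  case E: (l + p ^ j)%N => [|m] // _; rewrite /jet_rpow /ad_pred p_pred.
  by rewrite iterS (@jet_bracket_vanish _ _ (l + p ^ j).+1 0) // E addn0 ltnS.
apply/eqP; rewrite -subr_eq0; apply/eqP/jet_eqP => l; rewrite -/(om u).
pose low := \sum_(k < (l + p ^ j).+1) monomial_jet k (u k).
have -> : u = low + (u - low) by rewrite addrC subrK.
have om0 : om 0 = 0 by have := omD 0 0; rewrite addr0 => /eqP; rewrite -subr_eq subrr => /eqP.
rewrite omD jetD (big_morph om omD om0) big1 // add0r om_vanish // => i lt_i.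
rewrite jetD jetN (_ : low i = \sum_(k < (l + p ^ j).+1) monomial_jet k (u k) i); last exact: jet_sum.
rewrite (bigD1 (Ordinal lt_i)) //= {1}/monomial_jet eqxx big1 ?addr0 ?subrr //.
by move=> k ne_k; rewrite /monomial_jet ifN // eq_sym.
Qed.
End RestrictedJets.

(** * The four-term identity *)
Lemma four_coboundary (V : zmodType) (a b c d e f g h s : V) :
  (a - b - c) + (s - d - a) + (d - e - f)
    - ((g - e - b) + (h - f - c) + (s - g - h)) = 0.
Proof.
rewrite !opprD !opprK !addrA.
rewrite [LHS](ACl ((1*6)*(2*12)*(3*15)*(4*16)*(5*7)*(8*11)*(9*14)*(10*17)*(13*18))%AC) /=.
by rewrite !(addrN, addNr) !addr0.
Qed.

Section FourTerm.
Variables (p : nat) (F : fieldType).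
Hypothesis pF : p \in [pchar F].
Variable T : lieType F.
Local Notation J := (jets T).

Let p_gt1 : (1 < p)%N := prime_gt1 (pcharf_prime pF).
Let p_gt0 : (0 < p)%N := ltnW p_gt1.

(** The jet of t |-> x0 + t x1. *)
Definition line_jet (x0 x1 : T) : J := fun l =>
  match l with 0 => x0 | 1 => x1 | _ => 0 end.

Lemma line_jetD x0 x1 y0 y1 :
  line_jet x0 x1 + line_jet y0 y1 = line_jet (x0 + y0) (x1 + y1).
Proof. by apply: jet_eqP; case=> [|[|l]] //; exact: addr0. Qed.

Lemma bracket_line_jet x0 x1 (u : J) l :
  ⁅line_jet x0 x1, u⁆ l = ⁅x0, u l⁆ + l%:R *: ⁅x1, u l.-1⁆.
Proof.
have const x (v : J) k : ⁅line_jet x 0, v⁆ k = ⁅x, v k⁆.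
  elim: k v => [|k IH] v //; rewrite jet_bracketS IH.
  have -> : shift (line_jet x 0) = 0 by apply: jet_eqP; case.
  by rewrite bracket0l; exact: add0r.
elim: l u => [|l IH] u; first by rewrite scale0r addr0.
rewrite jet_bracketS IH (_ : shift (line_jet x0 x1) = line_jet x1 0); last first.
  by apply: jet_eqP; case=> [|[|k]].
rewrite const addrCA -[X in X + l%:R *: _]scale1r; case: l {IH} => [|l].
  by rewrite scale0r addr0 scale1r.
by rewrite /shift /= -scalerDl nat1r.
Qed.

(** The value at t = 1 of the polynomial of degree < p with these derivatives. *)
Definition jet_value (u : J) : T := \sum_(l < p) (l`!%:R : F)^-1 *: u l.

Lemma jet_value_linear : linear jet_value.
Proof.
move=> a u v; rewrite /jet_value scaler_sumr -big_split /=; apply: eq_bigr => l _.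
by rewrite jetD jetZ scalerDr !scalerA mulrC.
Qed.

Lemma fact_pchar_neq0 l : (l < p)%N -> l`!%:R != 0 :> F.
Proof.
move=> lt_lp; rewrite -(dvdn_pcharf pF); elim: l lt_lp => [|l IH] lt_lp.
  by rewrite fact0 dvdn1 neq_ltn p_gt1 orbT.
by rewrite factS (Euclid_dvdM _ _ (pcharf_prime pF)) gtnNdvd //= IH // ltnW.
Qed.

Lemma jet_value_bracket x0 x1 u : jet_value ⁅line_jet x0 x1, u⁆ =
  ⁅x0 + x1, jet_value u⁆ - (p.-1`!%:R : F)^-1 *: ⁅x1, u p.-1⁆.
Proof.
rewrite {1}/jet_value.
under eq_bigr => l _ do rewrite bracket_line_jet scalerDr -bracketZr.
rewrite big_split /= -(lin_sum (bracket_linear x0)) bracketDl -addrA; congr (_ + _).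
rewrite (lin_sum (bracket_linear x1)).
rewrite -(big_mkord xpredT (fun l => (l`!%:R : F)^-1 *: (l%:R *: ⁅x1, u l.-1⁆))).
rewrite -(big_mkord xpredT (fun l => ⁅x1, (l`!%:R : F)^-1 *: u l⁆)).
rewrite -{1 2}(prednK p_gt0) big_ltn // scale0r scaler0 add0r big_add1.
rewrite [in RHS]big_nat_recr //= bracketZr addrK; apply: eq_big_nat => l /= lt_l.
rewrite scalerA bracketZr factS natrM invfM mulrAC mulVf ?mul1r //.
by rewrite -(dvdn_pcharf pF) gtnNdvd // -ltn_predRL.
Qed.

Section Line.
Variables x0 x1 y0 y1 : T.
Local Notation X := (line_jet x0 x1).
Local Notation Y := (line_jet y0 y1).

(** Each bracket with x0 + t x1 or y0 + t y1 raises the degree in t by at most one,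
and only x1 and y1 contribute to the top degree; the factorial is the
normalization of divided powers. *)
Lemma adcoef_line_jet_top k j :
  (forall l, (k.+1 < l)%N -> adcoef X Y k j l = 0) /\
  adcoef X Y k j k.+1 = k.+1`!%:R *: adcoef x1 y1 k j.
Proof.
elim: k j => [|k IH] j.
  by split=> [[|[]] |] //; case: j => [|j] //=; rewrite ?scale1r ?scaler0.
split=> [l lt_kl|].
  have IHl j' : adcoef X Y k j' l = 0 by have [v _] := IH j'; exact/v/ltnW.
  have IHl1 j' : adcoef X Y k j' l.-1 = 0 by have [v _] := IH j'; apply: v; rewrite ltn_predRL.
  rewrite adcoefS jetD; case: j => [|j].
    by rewrite add0r bracket_line_jet IHl IHl1 !bracket0r scaler0 addr0.
  by rewrite !bracket_line_jet !IHl !IHl1 !bracket0r scaler0 !addr0.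
have IHl j' : adcoef X Y k j' k.+2 = 0 by have [v _] := IH j'; exact: v.
have IHl1 j' : adcoef X Y k j' k.+1 = k.+1`!%:R *: adcoef x1 y1 k j' by have [] := IH j'.
rewrite !adcoefS jetD; case: j => [|j].
  rewrite !add0r bracket_line_jet IHl IHl1 bracket0r !add0r bracketZr scalerA.
  by rewrite -natrM -factS.
rewrite !bracket_line_jet !IHl !IHl1 !bracket0r !add0r !bracketZr !scalerA.
by rewrite -natrM -factS -scalerDr.
Qed.

(** Evaluation at t = 1 commutes with brackets until t^p appears; divided powers
do not see the coefficient of t^p, which is the top coefficient reached for
k = p - 1. *)
Lemma jet_value_adcoef k j : (k < p)%N -> jet_value (adcoef X Y k j) =
  adcoef (x0 + x1) (y0 + y1) k j - (if k.+1 == p then adcoef x1 y1 k j else 0).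
Proof.
elim: k j => [|k IH] j lt_kp.
  rewrite (ltn_eqF p_gt1) subr0; case: j => [|j]; last exact: (lin0 jet_value_linear).
  rewrite /jet_value -(big_mkord xpredT (fun l => (l`!%:R : F)^-1 *: X l)).
  rewrite (big_cat_nat (n := 2)) //= [X in _ + X]big1_seq ?addr0; last first.
    by case=> [|[|l]] //=; rewrite ?mem_index_iota // scaler0.
  by rewrite big_ltn // big_nat1 !invr1 !scale1r.
have lt_kp' := ltnW lt_kp.
have step a0 a1 j' : jet_value ⁅line_jet a0 a1, adcoef X Y k j'⁆ =
    ⁅a0 + a1, adcoef (x0 + x1) (y0 + y1) k j'⁆
      - (if k.+2 == p then ⁅a1, adcoef x1 y1 k j'⁆ else 0).
  rewrite jet_value_bracket IH // (ltn_eqF lt_kp) subr0; congr (_ - _).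
  have [vanish top] := adcoef_line_jet_top k j'.
  have [e_kp|ne_kp] := eqVneq; last first.
    rewrite vanish ?bracket0r ?scaler0 //.
    by rewrite ltn_predRL ltn_neqAle ne_kp.
  rewrite -e_kp /= top bracketZr scalerA mulVf ?scale1r //.
  exact: fact_pchar_neq0.
rewrite adcoefS (linD jet_value_linear) step; case: j => [|j].
  by rewrite (lin0 jet_value_linear) !adcoefS !add0r.
rewrite step !adcoefS addrACA -opprD; congr (_ - _).
by case: ifP => // _; rewrite addr0.
Qed.

Lemma jet_value_jacobson_sum : jet_value (jacobson_sum p X Y) =
  jacobson_sum p (x0 + x1) (y0 + y1) - jacobson_sum p x1 y1.
Proof.
rewrite /jacobson_sum (lin_sum jet_value_linear) -sumrB; apply: eq_bigr => i _.
rewrite /jacobson_s (linZ jet_value_linear) jet_value_adcoef ?prednK ?ltnS //.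
by rewrite eqxx scalerBr.
Qed.
End Line.

(** The two sides come from two ways of gathering r + r' + u + u' in pairs, so they
would agree in the presence of a p-map.  In general, replace u and u' by t u and
t u'.  By [derivation_jacobson_sum] the difference of the two sides has zero
shift, hence is its value at t = 0, which vanishes.  Comparing with the value at
t = 1 gives the identity, up to the terms in t^p, which are Jacobson's sum
of u and u' on both sides. *)
Lemma jacobson_sum_four r r' u u' : jacobson_sum p u u'
    + jacobson_sum p (r + r') (u + u') + jacobson_sum p r r' =
  jacobson_sum p r u + jacobson_sum p r' u' + jacobson_sum p (r + u) (r' + u') :> T.
Proof.
pose R := line_jet r 0; pose R' := line_jet r' 0.
pose U := line_jet 0 u; pose U' := line_jet 0 u'.
pose P : J := jacobson_sum p U U' + jacobson_sum p (R + R') (U + U')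
  + jacobson_sum p R R'
  - (jacobson_sum p R U + jacobson_sum p R' U' + jacobson_sum p (R + U) (R' + U')).
have shiftP : shift P = 0.
  have ld := @shift_linear F T.
  rewrite /P !(linB ld, linD ld) !(derivation_jacobson_sum pF (@shift_derivation F T)).
  rewrite [R + R' + _]addrACA.
  exact: four_coboundary.
have P0 : P 0%N = 0.
  rewrite /P jetD jetN !jetD !(lie_hom_jacobson_sum (@ev0_hom F T)) /=.
  rewrite -[(R + R') 0%N]/(r + r') -[(U + U') 0%N]/(0 + 0 : T).
  rewrite -[(R + U) 0%N]/(r + 0) -[(R' + U') 0%N]/(r' + 0).
  by rewrite !addr0 !jacobson_sum0r // !add0r subrr.
have valP : jet_value P = 0.
  rewrite /jet_value big1 // => -[[|l] lt_l] _; first by rewrite P0 scaler0.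
  by rewrite -[P _]/(shift P l) shiftP scaler0.
move: valP; rewrite /P !(linB jet_value_linear, linD jet_value_linear) !line_jetD.
rewrite !jet_value_jacobson_sum !addr0 !add0r !jacobson_sum0l ?subr0 subrr add0r.
by move/subr0_eq=> E; rewrite -addrA E [LHS]addrC -addrA subrK.
Qed.
End FourTerm.

(** * Polynomials and p-polynomials *)
Section PolyAction.
Variables (F : fieldType) (T : lieType F).
Local Notation J := (jets T).
Implicit Types (P Q : {poly F}) (u v : J).

Definition poly_shift P u : J := fun l => \sum_(i < size P) P`_i *: u (l + i)%N.

Lemma poly_shiftE n P u l : (size P <= n)%N ->
  poly_shift P u l = \sum_(i < n) P`_i *: u (l + i)%N.
Proof.
move=> le_n; rewrite /poly_shift (big_ord_widen _ (fun i => P`_i *: u (l + i)%N) le_n).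
rewrite big_mkcond; apply: eq_bigr => i _; case: ltnP => // le_i.
by rewrite nth_default ?scale0r.
Qed.

Lemma poly_shift_linear P : linear (poly_shift P).
Proof.
move=> a u v; apply: jet_eqP => l; rewrite jetD jetZ /poly_shift scaler_sumr -big_split /=.
by apply: eq_bigr => i _; rewrite jetD jetZ scalerDr !scalerA mulrC.
Qed.

Lemma poly_shift_linearl u : linear (poly_shift^~ u).
Proof.
move=> a P Q; apply: jet_eqP => l; rewrite jetD jetZ.
pose n := maxn (size (a *: P + Q)) (maxn (size P) (size Q)).
rewrite !(@poly_shiftE n) ?leq_max ?leqnn ?orbT // scaler_sumr -big_split /=.
by apply: eq_bigr => i _; rewrite coefD coefZ scalerDl scalerA.
Qed.

Lemma poly_shiftXn n u : poly_shift 'X^n u = iter n (@shift F T) u.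
Proof.
apply: jet_eqP => l; rewrite iter_shiftE (@poly_shiftE n.+1) ?size_polyXn //.
rewrite (bigD1 ord_max) //= coefXn eqxx scale1r big1 ?addr0 // => i ne_i.
by rewrite coefXn (negPf (_ : (i != n :> nat))) ?scale0r.
Qed.

Lemma poly_shiftMXn P n u : poly_shift (P * 'X^n) u = poly_shift P (iter n (@shift F T) u).
Proof.
apply: jet_eqP => l; rewrite (@poly_shiftE (n + size P)); last first.
  by rewrite (leq_trans (size_polyMleq _ _)) // size_polyXn addnS addnC.
rewrite big_split_ord /= big1 ?add0r; last first.
  by move=> i _; rewrite coefMXn ltn_ord scale0r.
apply: eq_bigr => i _; rewrite coefMXn ltnNge leq_addr /= addKn.
by congr (_ *: _); rewrite iter_shiftE addnA addnAC.
Qed.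

Lemma poly_shiftM P Q u : poly_shift (P * Q) u = poly_shift P (poly_shift Q u).
Proof.
rewrite -[Q]coefK poly_def mulr_sumr !(lin_sum (poly_shift_linearl _)).
rewrite (lin_sum (poly_shift_linear _)); apply: eq_bigr => i _.
rewrite -scalerAr !(linZ (poly_shift_linearl _)) (linZ (poly_shift_linear _)).
by rewrite poly_shiftMXn poly_shiftXn.
Qed.

Lemma poly_shift1 u : poly_shift 1 u = u.
Proof. by rewrite -(expr0 'X) poly_shiftXn. Qed.
End PolyAction.

Section PPolynomials.
Variables (p : nat) (F : fieldType).
Hypothesis pF : p \in [pchar F].
Implicit Types r s : {poly F}.
Let p_gt1 : (1 < p)%N := prime_gt1 (pcharf_prime pF).
Let p_gt0 : (0 < p)%N := ltnW p_gt1.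

(** A p-polynomial is stored by its coefficients: the coefficient of 'X^j stands
for that of the p^j-th power.  This is the underlying ordinary polynomial. *)
Definition ppoly_eval r : {poly F} := \sum_(j < size r) r`_j *: 'X^(p ^ j).

Lemma ppoly_evalE n r : (size r <= n)%N -> ppoly_eval r = \sum_(j < n) r`_j *: 'X^(p ^ j).
Proof.
move=> le_n; rewrite /ppoly_eval (big_ord_widen _ (fun j => r`_j *: 'X^(p ^ j)) le_n).
rewrite big_mkcond; apply: eq_bigr => i _; case: ltnP => // le_i.
by rewrite nth_default ?scale0r.
Qed.

Lemma ppoly_eval_linear : linear ppoly_eval.
Proof.
move=> a r s; pose n := maxn (size (a *: r + s)) (maxn (size r) (size s)).
rewrite !(@ppoly_evalE n) ?leq_max ?leqnn ?orbT // scaler_sumr -big_split /=.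
by apply: eq_bigr => i _; rewrite coefD coefZ scalerDl scalerA.
Qed.

Lemma ppoly_evalXn n : ppoly_eval 'X^n = 'X^(p ^ n).
Proof.
rewrite (@ppoly_evalE n.+1) ?size_polyXn // (bigD1 ord_max) //= coefXn eqxx scale1r.
by rewrite big1 ?addr0 // => i ne_i; rewrite coefXn (negPf (_ : (i != n :> nat))) ?scale0r.
Qed.

(** The p-th power of a p-polynomial, in terms of the stored coefficients. *)
Definition ppoly_frob r : {poly F} := map_poly (pFrobenius_aut pF) r * 'X.

Lemma ppoly_frobD r s : ppoly_frob (r + s) = ppoly_frob r + ppoly_frob s.
Proof. by rewrite /ppoly_frob rmorphD mulrDl. Qed.
Lemma ppoly_frobZ a r : ppoly_frob (a *: r) = a ^+ p *: ppoly_frob r.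
Proof. by rewrite /ppoly_frob map_polyZ scalerAl. Qed.
Lemma ppoly_frobXn n : ppoly_frob 'X^n = 'X^(n.+1).
Proof. by rewrite /ppoly_frob map_polyXn exprSr. Qed.

Lemma ppoly_eval_frob r : ppoly_eval (ppoly_frob r) = ppoly_eval r ^+ p.
Proof.
have pP : p \in [pchar {poly F}] := pchar_poly_alg pF F^o.
rewrite -[r in LHS]coefK -[r in RHS]coefK poly_def (lin_sum ppoly_eval_linear).
rewrite -(pFrobenius_autE pP) (raddf_sum (pFrobenius_aut pP)).
rewrite (big_morph _ ppoly_frobD (_ : ppoly_frob 0 = 0)); last first.
  by rewrite /ppoly_frob rmorph0 mul0r.
rewrite (lin_sum ppoly_eval_linear); apply: eq_bigr => i _.
rewrite ppoly_frobZ ppoly_frobXn !(linZ ppoly_eval_linear) !ppoly_evalXn.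
rewrite /= pFrobenius_autE exprZn -exprM. by rewrite expnSr.
Qed.
Definition ppoly of p \in [pchar F] : Type := {poly F}.
Local Notation R := (ppoly pF).
HB.instance Definition _ := GRing.Lmodule.on R.

Fact ppoly_bracketDl (r s t : R) : (0 : R) = 0 + 0. Proof. by rewrite addr0. Qed.
Fact ppoly_bracketZ (a : F) (r s : R) : (0 : R) = a *: 0. Proof. by rewrite scaler0. Qed.
Fact ppoly_jacobi (r s t : R) : (0 : R) + 0 + 0 = 0. Proof. by rewrite !addr0. Qed.
HB.instance Definition _ := @Lmodule_isLie.Build F R (fun _ _ => 0)
  ppoly_bracketDl ppoly_bracketDl ppoly_bracketZ ppoly_bracketZ (fun _ => erefl) ppoly_jacobi.

Fact ppoly_rpowZ (a : F) (r : R) : (ppoly_frob (a *: r) : R) = a ^+ p *: (ppoly_frob r : R).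
Proof. exact: ppoly_frobZ. Qed.
Fact ppoly_bracket_rpow (r s : R) : ⁅(ppoly_frob r : R), s⁆ = iter p (bracket r) s.
Proof. by rewrite -(prednK p_gt0). Qed.
Fact ppoly_rpowD (r s : R) : (ppoly_frob (r + s) : R) =
  (ppoly_frob r : R) + (ppoly_frob s : R) + \sum_(1 <= i < p) jacobson_s p r s i.
Proof.
rewrite -/(jacobson_sum p r s) jacobson_sum_commuting // addr0.
exact: ppoly_frobD.
Qed.
HB.instance Definition _ := Lie_isRestricted.Build p F R
  ppoly_rpowZ ppoly_bracket_rpow ppoly_rpowD.
End PPolynomials.

(** * The wreath product *)
Section DerivationSums.
Variables (F : fieldType) (T : lieType F).
Lemma derivation_sum (I : Type) (r : seq I) (c : I -> F) (d : I -> T -> T) :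
  (forall i, lie_derivation (d i)) ->
  lie_derivation (fun u => \sum_(i <- r) c i *: d i u).
Proof.
move=> der; split=> [a x y|x y].
  rewrite scaler_sumr -big_split /=; apply: eq_bigr => i _.
  by rewrite (derivation_linear (der i)) scalerDr !scalerA mulrC.
rewrite (lin_sum (bracket_linearl y)) (lin_sum (bracket_linear x)) -big_split /=.
apply: eq_bigr => i _.
by rewrite (derivation_bracket (der i)) scalerDr bracketZl bracketZr.
Qed.
End DerivationSums.

Section Wreath.
Variables (p : nat) (F : fieldType).
Hypothesis pF : p \in [pchar F].
Let p_gt1 : (1 < p)%N := prime_gt1 (pcharf_prime pF).
Let p_gt0 : (0 < p)%N := ltnW p_gt1.

Section ActionLie.
Variable T : lieType F.
Local Notation J := (jets T).
Implicit Types (u v w : J) (r s t : {poly F}).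

Definition ppoly_shift r : J -> J := poly_shift (ppoly_eval p r).

Lemma ppoly_shiftE r u :
  ppoly_shift r u = \sum_(j < size r) r`_j *: iter (p ^ j) (@shift F T) u.
Proof.
rewrite /ppoly_shift /ppoly_eval (lin_sum (poly_shift_linearl _)).
by apply: eq_bigr => j _; rewrite (linZ (poly_shift_linearl _)) poly_shiftXn.
Qed.

Lemma ppoly_shift_derivation r : lie_derivation (ppoly_shift r).
Proof.
have -> : ppoly_shift r = fun u => \sum_(j < size r) r`_j *: iter (p ^ j) (@shift F T) u.
  by apply/funext => u; exact: ppoly_shiftE.
apply: derivation_sum => j; exact/derivation_iter_pcharX/shift_derivation.
Qed.
End ActionLie.

Variable H : rlieType p F.
Local Notation J := (jets H).
Implicit Types (u v w : J) (r s t : {poly F}).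

Lemma ppoly_shift_jet_rpow r u :
  ppoly_shift r (jet_rpow u) = ad_pred p (@ppoly_shift H r) u.
Proof.
rewrite /ad_pred !ppoly_shiftE (lin_sum (iter_bracket_linear _ _)).
apply: eq_bigr => j _; rewrite (linZ (iter_bracket_linear _ _)); congr (_ *: _).
exact: iter_shift_jet_rpow.
Qed.

(** The semidirect product of the abelian algebra of p-polynomials by the jets. *)
Definition wreath of p \in [pchar F] : Type := ({poly F} * J)%type.
Local Notation E := (wreath pF).
HB.instance Definition _ := GRing.Lmodule.on E.

Definition wreath_bracket (X Y : E) : E :=
  (0, ppoly_shift X.1 Y.2 - ppoly_shift Y.1 X.2 + ⁅X.2, Y.2⁆).

Lemma ppoly_shift_linear r : linear (@ppoly_shift H r).
Proof. exact: poly_shift_linear. Qed.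
Lemma ppoly_shift_linearl u : linear (fun r => ppoly_shift r u).
Proof.
by move=> a r s; rewrite /ppoly_shift (ppoly_eval_linear p) (poly_shift_linearl _).
Qed.
Lemma ppoly_shiftC r s u : ppoly_shift r (ppoly_shift s u) = ppoly_shift s (ppoly_shift r u).
Proof. by rewrite /ppoly_shift -!poly_shiftM mulrC. Qed.

Fact wreath_bracket_linear X : linear (wreath_bracket X).
Proof.
move=> a Y Z; congr (_, _); first by rewrite /= scaler0 addr0.
rewrite /= (ppoly_shift_linear X.1) (ppoly_shift_linearl X.2) (bracket_linear X.2) !scalerDr scalerN opprD.
by rewrite !addrA [LHS](ACl (1*3*5*2*4*6)%AC).
Qed.
Fact wreath_bracketC X Y : wreath_bracket X Y = - wreath_bracket Y X.
Proof.
congr (_, _); first by rewrite /= oppr0.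
by rewrite /= bracketC opprD opprB.
Qed.
Fact wreath_bracketDr X Y Z :
  wreath_bracket X (Y + Z) = wreath_bracket X Y + wreath_bracket X Z.
Proof. exact: (linD (wreath_bracket_linear X)). Qed.
Fact wreath_bracketZr a X Y : wreath_bracket X (a *: Y) = a *: wreath_bracket X Y.
Proof. exact: (linZ (wreath_bracket_linear X)). Qed.
Fact wreath_bracketDl X Y Z :
  wreath_bracket (X + Y) Z = wreath_bracket X Z + wreath_bracket Y Z.
Proof. by rewrite ![wreath_bracket _ Z]wreath_bracketC wreath_bracketDr opprD. Qed.
Fact wreath_bracketZl a X Y : wreath_bracket (a *: X) Y = a *: wreath_bracket X Y.
Proof. by rewrite ![wreath_bracket _ Y]wreath_bracketC wreath_bracketZr scalerN. Qed.
Fact wreath_bracketxx X : wreath_bracket X X = 0.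
Proof. by congr (_, _); rewrite /= subrr bracketxx addr0. Qed.
Fact wreath_jacobi X Y Z :
  wreath_bracket X (wreath_bracket Y Z) + wreath_bracket Y (wreath_bracket Z X)
    + wreath_bracket Z (wreath_bracket X Y) = 0.
Proof.
case: X Y Z => [r u] [s v] [t w]; congr (_, _); first by rewrite /= !addr0.
rewrite /= !(lin0 (ppoly_shift_linearl _)) !subr0.
rewrite !(linB (ppoly_shift_linear _), linD (ppoly_shift_linear _)).
rewrite !(derivation_bracket (ppoly_shift_derivation _ _)) !bracketDr !bracketNr.
rewrite (ppoly_shiftC r s) (ppoly_shiftC r t) (ppoly_shiftC s t).
rewrite (bracketC (ppoly_shift r v)) (bracketC (ppoly_shift s w)) (bracketC (ppoly_shift t u)).
rewrite !addrA.
rewrite [LHS](ACl ((1*9)*(2*15)*(3*19)*(4*13)*(5*10)*(6*18)*(8*16)*(11*20)*(12*17)*(7*14*21))%AC) /=.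
by rewrite !(addrN, addNr) !add0r bracket_jacobi.
Qed.
HB.instance Definition _ := Lmodule_isLie.Build F E wreath_bracketDl wreath_bracketDr
  wreath_bracketZl wreath_bracketZr wreath_bracketxx wreath_jacobi.

Definition top r : E := (r, 0).
Definition base u : E := (0, u).

Lemma wreathE X Y : ⁅X, Y⁆ =
  base (ppoly_shift X.1 Y.2 - ppoly_shift Y.1 X.2 + ⁅X.2, Y.2⁆) :> E.
Proof. by []. Qed.

Lemma top_base (X : E) : X = top X.1 + base X.2.
Proof. by case: X => r u; congr (_, _); rewrite /= ?addr0 ?add0r. Qed.

Lemma base_hom : lie_hom base.
Proof.
split=> [a u v|u v]; first by congr (_, _); rewrite /= scaler0 addr0.
by rewrite wreathE /= !(lin0 (ppoly_shift_linearl _)) subrr add0r.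
Qed.

Lemma top_linear : linear top.
Proof. by move=> a r s; congr (_, _); rewrite /= scaler0 addr0. Qed.

Lemma bracket_top_base r u : ⁅top r, base u⁆ = base (ppoly_shift r u).
Proof. by rewrite wreathE /= bracket0l addr0 (lin0 (ppoly_shift_linearl _)) subr0. Qed.

Lemma bracket_top_top r s : ⁅top r, top s⁆ = 0.
Proof.
by rewrite wreathE /= !(lin0 (ppoly_shift_linear _)) subrr bracket0l add0r.
Qed.

Lemma iter_bracket_top_base r n u :
  iter n (bracket (top r)) (base u) = base (poly_shift (ppoly_eval p r ^+ n) u).
Proof.
elim: n => [|n IH] /=; first by rewrite poly_shift1.
by rewrite IH bracket_top_base /ppoly_shift exprS poly_shiftM.
Qed.

(** Forced by additivity of the p-map up to Jacobson's sum. *)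
Definition wreath_rpow (X : E) : E :=
  top (ppoly_frob pF X.1) + base (jet_rpow X.2) + jacobson_sum p (top X.1) (base X.2).

Fact wreath_rpowZ a X : wreath_rpow (a *: X) = a ^+ p *: wreath_rpow X.
Proof.
rewrite /wreath_rpow /= ppoly_frobZ jet_rpowZ // !scalerDr.
rewrite !(linZ top_linear) !(linZ (lie_hom_linear base_hom)).
by rewrite jacobson_sum_scale.
Qed.

(** The adjoint action of Jacobson's sum is known in every Lie algebra, so it is enough
to treat the two factors; for the jets this is the compatibility of u^[p] with
the p-polynomials in the shift. *)
Fact wreath_bracket_rpow X Y : ⁅wreath_rpow X, Y⁆ = iter p (bracket X) Y.
Proof.
have iter_pred (A : Type) (f : A -> A) x : iter p f x = iter p.-1 f (f x).
  by rewrite -iterSr prednK.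
have topP r : ⁅top (ppoly_frob pF r), Y⁆ = iter p (bracket (top r)) Y.
  rewrite (top_base Y) bracketDr (linD (iter_bracket_linear _ _)); congr (_ + _).
    rewrite bracket_top_top iter_pred bracket_top_top.
    by rewrite (lin0 (iter_bracket_linear _ _)).
  by rewrite iter_bracket_top_base -ppoly_eval_frob bracket_top_base.
have baseP u : ⁅base (jet_rpow u), Y⁆ = iter p (bracket (base u)) Y.
  rewrite (top_base Y) bracketDr (linD (iter_bracket_linear _ _)); congr (_ + _); last first.
    by rewrite -(lie_hom_bracket base_hom) -(lie_hom_iter base_hom) jet_bracket_rpow.
  rewrite iter_pred ![⁅base _, top _⁆]bracketC !bracket_top_base.
  rewrite (linN (iter_bracket_linear _ _)) -(lie_hom_iter base_hom).
  by rewrite ppoly_shift_jet_rpow.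
rewrite /wreath_rpow !bracketDl topP baseP (bracket_jacobson_sum pF) -top_base.
by rewrite addr_subr2.
Qed.

Fact wreath_rpowD X Y : wreath_rpow (X + Y) =
  wreath_rpow X + wreath_rpow Y + \sum_(1 <= i < p) jacobson_s p X Y i.
Proof.
rewrite -/(jacobson_sum p X Y) /wreath_rpow /= ppoly_frobD (jet_rpowD pF).
rewrite !(linD top_linear) !(linD (lie_hom_linear base_hom)) (lie_hom_jacobson_sum base_hom).
have := jacobson_sum_four pF (top X.1) (top Y.1) (base X.2) (base Y.2).
rewrite -!top_base (jacobson_sum_commuting p_gt1 (bracket_top_top _ _)) addr0 => E4.
rewrite !addrA [LHS](ACl (1*2*3*4*(5*6))%AC) /= E4 !addrA.
by rewrite [RHS](ACl (1*4*2*5*3*6*7)%AC).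
Qed.

HB.instance Definition _ := Lie_isRestricted.Build p F E
  wreath_rpowZ wreath_bracket_rpow wreath_rpowD.

Lemma wreath_rpowE (X : E) : X^[p] =
  top (ppoly_frob pF X.1) + base (jet_rpow X.2) + jacobson_sum p (top X.1) (base X.2).
Proof. by []. Qed.

Lemma fst_wreath_hom : rlie_hom (fun X : E => X.1 : ppoly pF).
Proof.
have h : lie_hom (fun X : E => X.1 : ppoly pF) by [].
split=> // X; rewrite wreath_rpowE /= (lie_hom_jacobson_sum h) /=.
by rewrite (jacobson_sum0r _ p_gt1) !addr0.
Qed.

End Wreath.

(** * Generators of free restricted Lie algebras *)
Section RestrictedBasics.
Variables (p : nat) (F : fieldType).
Implicit Types L H K : rlieType p F.

Lemma rlie_lie_hom L H (f : L -> H) : rlie_hom f -> lie_hom f.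
Proof. by case=> lf bf _; split. Qed.

Lemma rlie_hom_id L : rlie_hom (fun x : L => x).
Proof. by split. Qed.

Lemma rlie_hom_comp L H K (g : H -> K) (f : L -> H) :
  rlie_hom g -> rlie_hom f -> rlie_hom (fun x => g (f x)).
Proof.
move=> [lg bg rg] [lf bf rf]; split=> [a x y|x y|x]; first by rewrite lf lg.
  by rewrite bf bg.
by rewrite rf rg.
Qed.

Lemma rlie_hom_iter_rpow L H (f : L -> H) j x :
  rlie_hom f -> f (iter j (@rpow p F L) x) = iter j (@rpow p F H) (f x).
Proof. by move=> [_ _ rf]; elim: j => //= j <-; rewrite rf. Qed.

Lemma rpow_jacobson L (x y : L) : (x + y)^[p] = x^[p] + y^[p] + jacobson_sum p x y.
Proof. exact: rpowD. Qed.

Section PropSubalg.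
Variables (L : rlieType p F) (P : L -> Prop).
Hypotheses (P0 : P 0) (PD : forall a x y, P x -> P y -> P (a *: x + y)).
Hypothesis Pb : forall x y, P x -> P y -> P ⁅x, y⁆.
Hypothesis Pp : forall x, P x -> P x^[p].

Fact prop_rsubalg_submod : submod_closed [pred x | `[< P x >]].
Proof.
by split=> [|a x y /asboolP Px /asboolP Py]; apply/asboolP; [exact: P0 | exact: PD].
Qed.
Fact prop_rsubalg_bracket : {in [pred x | `[< P x >]] &, forall x y, ⁅x, y⁆ \in [pred x | `[< P x >]]}.
Proof. by move=> x y /asboolP Px /asboolP Py; apply/asboolP/Pb. Qed.
Fact prop_rsubalg_rpow : {in [pred x | `[< P x >]], forall x, x^[p] \in [pred x | `[< P x >]]}.
Proof. by move=> x /asboolP Px; apply/asboolP/Pp. Qed.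
Definition prop_rsubalg : rsubalg L :=
  RSubalg prop_rsubalg_submod prop_rsubalg_bracket prop_rsubalg_rpow.

Lemma in_prop_rsubalg x : (x \in prop_rsubalg) <-> P x.
Proof. by split=> [/asboolP|Px] //; apply/asboolP. Qed.
End PropSubalg.

Lemma free_generated L X (x : X -> L) (S : rsubalg L) :
  rlie_free_on x -> (forall i, x i \in S) -> forall z, z \in S.
Proof.
move=> free xS z; have [f [hf fx _]] := free (rsub S) (fun i => RSub (xS i)).
have [g [_ _ uniq]] := free L x.
have -> : z = rsub_val (f z).
  have fxE i : rsub_val (f (x i)) = x i by rewrite fx.
  have := uniq _ (rlie_hom_comp (rsub_val_hom S) hf) fxE z.
  by rewrite -(uniq _ (rlie_hom_id L) (fun=> erefl) z).
exact: (valP (f z)).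
Qed.

Lemma free_induction L X (x : X -> L) (P : L -> Prop) : rlie_free_on x ->
  P 0 -> (forall a y z, P y -> P z -> P (a *: y + z)) ->
  (forall y z, P y -> P z -> P ⁅y, z⁆) -> (forall y, P y -> P y^[p]) ->
  (forall i, P (x i)) -> forall z, P z.
Proof.
move=> free P0 PD Pb Pp Px z; apply/(in_prop_rsubalg P0 PD Pb Pp).
by apply: free_generated free _ _ => i; apply/in_prop_rsubalg.
Qed.

(** The inverse change of generators subtracts the same term. *)
Lemma free_elementary L (X : eqType) (x : X -> L) (k i : X) c e :
  rlie_free_on x -> i != k ->
  rlie_free_on (fun l => if l == k then x k + c *: iter e (@rpow p F L) (x i) else x l).
Proof.
move=> free ne_ik H h.
pose h' l := if l == k then h k - c *: iter e (@rpow p F H) (h i) else h l.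
have [f [hf fx uniq]] := free H h'; exists f; split=> // [l|g hg gx z].
  case: eqP => [->|/eqP ne_lk]; last by rewrite fx /h' (negPf ne_lk).
  have [lf _ _] := hf; rewrite (linD lf) (linZ lf) (rlie_hom_iter_rpow _ _ hf) !fx /h'.
  by rewrite eqxx (negPf ne_ik) subrK.
apply: uniq => // l; rewrite /h'; case: eqP => [->|/eqP ne_lk].
  have := gx k; have := gx i; rewrite eqxx (negPf ne_ik) => gi <-.
  have [lg _ _] := hg; rewrite (linD lg) (linZ lg) (rlie_hom_iter_rpow _ _ hg) gi.
  by rewrite addrK.
by have := gx l; rewrite (negPf ne_lk).
Qed.
End RestrictedBasics.

(** * Evaluating p-polynomials *)
Section PPolyEval.
Variables (p : nat) (F : fieldType).
Hypothesis pF : p \in [pchar F].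
Let p_gt1 : (1 < p)%N := prime_gt1 (pcharf_prime pF).
Let p_gt0 : (0 < p)%N := ltnW p_gt1.
Local Notation R := (ppoly pF).

Let iter_pred (A : Type) (f : A -> A) x : iter p f x = iter p.-1 f (f x).
Proof. by rewrite -iterSr prednK. Qed.

Section Target.
Variables (B : rlieType p F) (s : B).
Local Notation sp j := (iter j (@rpow p F B) s).

Lemma rpow0 (C : rlieType p F) : (0 : C)^[p] = 0.
Proof. by have := rpowZ 0 (0 : C); rewrite !scaler0 expr0n gtn_eqF // scale0r. Qed.

Lemma rpow_commuting (C : rlieType p F) (x y : C) : ⁅x, y⁆ = 0 -> (x + y)^[p] = x^[p] + y^[p].
Proof. by move=> xy; rewrite rpow_jacobson jacobson_sum_commuting ?addr0. Qed.

Lemma iter_rpow_commute i j : ⁅sp i, sp j⁆ = 0.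
Proof.
have commute_iter (x y : B) k : ⁅x, y⁆ = 0 -> ⁅iter k (@rpow p F B) x, y⁆ = 0.
  move=> xy; elim: k => //= k IH; rewrite bracket_rpow iter_pred IH.
  by rewrite (lin0 (iter_bracket_linear _ _)).
by apply: (commute_iter); rewrite bracketC commute_iter ?oppr0 // bracketxx.
Qed.

(** The homomorphism from the free algebra on one generator 'X^0 that sends this
generator to s; it is the right multiplication by s in the skew polynomial
ring when s is itself a p-polynomial. *)
Definition ppoly_at (r : {poly F}) : B := \sum_(j < size r) r`_j *: sp j.

Lemma ppoly_atE n (r : {poly F}) : (size r <= n)%N -> ppoly_at r = \sum_(j < n) r`_j *: sp j.
Proof.
move=> le_n; rewrite /ppoly_at (big_ord_widen _ (fun j => r`_j *: sp j) le_n).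
rewrite big_mkcond; apply: eq_bigr => i _; case: ltnP => // le_i.
by rewrite nth_default ?scale0r.
Qed.

Lemma ppoly_at_linear : linear (ppoly_at : R -> B).
Proof.
move=> a r s'; pose n := maxn (size (a *: r + s' : {poly F})) (maxn (size r) (size s')).
rewrite !(@ppoly_atE n) ?leq_max ?leqnn ?orbT // scaler_sumr -big_split /=.
by apply: eq_bigr => i _; rewrite coefD coefZ scalerDl scalerA.
Qed.

Lemma ppoly_atXn n : ppoly_at 'X^n = sp n.
Proof.
rewrite (@ppoly_atE n.+1) ?size_polyXn // (bigD1 ord_max) //= coefXn eqxx scale1r.
by rewrite big1 ?addr0 // => i ne_i; rewrite coefXn (negPf (_ : (i != n :> nat))) ?scale0r.
Qed.

Lemma rpow_sum_commuting (C : rlieType p F) n (y : 'I_n -> C) :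
  (forall i j, ⁅y i, y j⁆ = 0) -> (\sum_i y i)^[p] = \sum_i (y i)^[p].
Proof.
elim: n y => [|n IH] y yy; first by rewrite !big_ord0 rpow0.
rewrite !big_ord_recr /= rpow_commuting ?IH //.
by rewrite (lin_sum (bracket_linearl _)) big1.
Qed.

Lemma ppoly_at_hom : rlie_hom (ppoly_at : R -> B).
Proof.
split=> [|r t|r]; first exact: ppoly_at_linear.
  rewrite (lin0 ppoly_at_linear) /ppoly_at (lin_sum (bracket_linearl _)) big1 // => i _.
  rewrite (lin_sum (bracket_linear _)) big1 // => j _.
  by rewrite bracketZl bracketZr iter_rpow_commute !scaler0.
rewrite [RHS]rpow_sum_commuting => [|i j]; last first.
  by rewrite bracketZl bracketZr iter_rpow_commute !scaler0.
rewrite -[r in LHS]coefK poly_def.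
have fE : ppoly_frob pF (\sum_(i < size r) r`_i *: 'X^i) = \sum_(i < size r) r`_i ^+ p *: 'X^(i.+1).
  rewrite (big_morph _ (ppoly_frobD pF) (_ : ppoly_frob pF 0 = 0)); last first.
    by rewrite /ppoly_frob rmorph0 mul0r.
  by apply: eq_bigr => i _; rewrite ppoly_frobZ ppoly_frobXn.
rewrite -[_^[p]]/(ppoly_frob pF _) fE (lin_sum ppoly_at_linear); apply: eq_bigr => i _.
by rewrite (linZ ppoly_at_linear) ppoly_atXn rpowZ.
Qed.
End Target.

Lemma coef_ppoly_at c e (r : {poly F}) t :
  (ppoly_at (c *: 'X^e : R) r : {poly F})`_t =
    if (t < e)%N then 0 else r`_(t - e) * c ^+ (p ^ (t - e)).
Proof.
have iterE j : iter j (@rpow p F R) (c *: 'X^e : R) = c ^+ (p ^ j) *: 'X^(e + j) :> {poly F}.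
  elim: j => [|j IH]; first by rewrite expr1 addn0.
  by rewrite iterS IH [LHS]ppoly_frobZ ppoly_frobXn addnS -exprM expnSr.
rewrite (@ppoly_atE _ _ (size r + t).+1) ?leqW ?leq_addr //.
rewrite (big_morph (fun P : R => (P : {poly F})`_t) (id1 := 0) (op1 := +%R)); last 2 first.
- by move=> P Q; rewrite coefD.
- by rewrite coef0.
case: ltnP => [lt_te|le_et].
  apply: big1 => j _; rewrite coefZ iterE coefZ coefXn (ltn_eqF (leq_trans lt_te _)) ?mulr0 //.
  exact: leq_addr.
have lt_t : (t - e < (size r + t).+1)%N by rewrite ltnS (leq_trans (leq_subr _ _)) ?leq_addl.
rewrite (bigD1 (Ordinal lt_t)) //= big1 ?addr0 => [|j ne_j].
  by rewrite coefZ iterE coefZ coefXn subnKC // eqxx mulr1.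
rewrite coefZ iterE coefZ coefXn (_ : (t == e + j)%N = false) ?mulr0 //.
by apply: contraNF ne_j => /eqP E; apply/eqP/val_inj; rewrite /= [X in (X - _)%N]E addKn.
Qed.
End PPolyEval.

(** * Euclidean elimination of relations *)
Section Frames.
Variables (p : nat) (F : fieldType).
Hypothesis perfF : perfect_pchar p F.
Let pF : p \in [pchar F] := perfF.1.
Local Notation R := (ppoly pF).
Variables (L : rlieType p F) (n : nat).

(** Free generators together with the dual coordinates of the maximal abelian
quotient, with values in the p-polynomials. *)
Definition dual_frame (x : 'I_n -> L) (rho : 'I_n -> L -> R) : Prop :=
  rlie_free_on x /\ forall i, rlie_hom (rho i) /\
    forall l, rho i (x l) = if l == i then (1 : {poly F}) else 0.

Lemma dual_frame_exists (x : 'I_n -> L) : rlie_free_on x -> exists rho, dual_frame x rho.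
Proof.
move=> free; pose h (i l : 'I_n) : R := if l == i then (1 : {poly F}) else 0.
have /choice[rho hrho] (i : 'I_n) : exists f : L -> R, rlie_hom f /\ forall l, f (x l) = h i l.
  by have [f [hf fx _]] := free R (h i); exists f.
by exists rho.
Qed.

Lemma perfect_root (a : F) j : exists b : F, b ^+ (p ^ j) = a.
Proof.
elim: j a => [|j IH] a; first by exists a.
have [b <-] := perfF.2 a; have [c <-] := IH b.
by exists c; rewrite -exprM expnSr.
Qed.

(** A change of one generator changes one coordinate, by a right multiple of another. *)
Lemma dual_frame_elementary x rho k i (c : F) e : dual_frame x rho -> i != k ->
  exists x', dual_frame x' (fun l => if l == i
    then fun z => rho i z - ppoly_at (c *: 'X^e : R) (rho k z) else rho l).
Proof.
move=> [free dual] ne_ik; set s : R := c *: 'X^e.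
exists (fun l => if l == k then x k + c *: iter e (@rpow p F L) (x i) else x l).
split; first exact: free_elementary.
have iterR0 j : iter j (@rpow p F R) 0 = 0 by elim: j => //= j ->; rewrite rpow0.
have iterR1 j : iter j (@rpow p F R) (1 : {poly F}) = ('X^j : {poly F}).
  by elim: j => [|j IH]; rewrite ?expr0 // iterS IH [LHS]ppoly_frobXn.
move=> j; case: eqP => [->|/eqP ne_ji]; last first.
  have [hj xj] := dual j; split=> // l; have [lj _ _] := hj; case: eqP => [->|_] //.
  rewrite (linD lj) (linZ lj) (rlie_hom_iter_rpow _ _ hj) !xj.
  by rewrite [i == j]eq_sym (negPf ne_ji) iterR0 scaler0 addr0.
have [hi xi] := dual i; have [hk xk] := dual k.
have hs := ppoly_at_hom pF s.
have [[[li bi ri] [lk bk rk]] [ls bs rs]] := (hi, hk, hs).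
split; first split=> [a y z|y z|y].
- by rewrite li lk ls scalerBr opprD addrACA.
- by rewrite bi bk bs subr0.
- by rewrite ri rk rs; apply/eqP; rewrite subr_eq -rpow_commuting ?subrK.
move=> l; case: eqP => [->|/eqP ne_lk]; last first.
  by rewrite xi xk (negPf ne_lk) (lin0 ls) subr0.
rewrite (linD li) (linD lk) !(linZ li, linZ lk) !(rlie_hom_iter_rpow _ _ hi, rlie_hom_iter_rpow _ _ hk).
rewrite !xi !xk !eqxx eq_sym (negPf ne_ik) iterR0 iterR1 scaler0 addr0 add0r.
by rewrite -(expr0 'X) ppoly_atXn subrr.
Qed.

(** The leading coefficient of s is multiplied by a power c^(p^k), so c is found by
extracting a p^k-th root. *)
Lemma euclid_step (r s : {poly F}) : r != 0 -> s != 0 -> (size s <= size r)%N ->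
  exists c e, (size (r - ppoly_at (c *: 'X^e : R) s : {poly F})%R < size r)%N.
Proof.
move=> r0 s0 le_sr; pose e := (size r - size s)%N.
have [c hc] := perfect_root (lead_coef r / lead_coef s) (size s).-1.
exists c, e; have szr : (0 < size r)%N by rewrite size_poly_gt0.
have szs : (0 < size s)%N by rewrite size_poly_gt0.
rewrite -(prednK szr) ltnS; apply/leq_sizeP => t le_t.
rewrite coefB coef_ppoly_at.
have le_et : (e <= t)%N.
  by rewrite (leq_trans _ le_t) // /e leq_subLR -(prednK szs) addSn -(prednK szr) ltnS leq_addl.
rewrite ltnNge le_et /=; move: le_t; rewrite leq_eqVlt => /predU1P[<-|lt_t].
  have -> : ((size r).-1 - e = (size s).-1)%N.
    by rewrite /e -!subn1 subnAC subKn.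
  by rewrite hc mulrC divfK ?lead_coef_eq0 // subrr.
rewrite prednK // in lt_t; rewrite nth_default // nth_default ?mul0r ?subr0 //.
by rewrite leq_subRL // /e subnK.
Qed.

(** Euclid's algorithm on the coordinates of w that are indexed by S, by induction
on the sum of their sizes; at most one nonzero coordinate is left at the
end, and its index is dropped from S.  The words satisfying P, whose coordinates
in S are already zero, keep this property. *)
Lemma euclid_word (S : {set 'I_n}) (P : L -> Prop) w x rho : dual_frame x rho ->
  (forall z i, P z -> i \in S -> rho i z = 0) ->
  exists x' rho' (S' : {set 'I_n}), [/\ dual_frame x' rho', S' \subset S, (#|S| <= #|S'|.+1)%N,
    forall z i, P z -> i \in S -> rho' i z = 0 & forall i, i \in S' -> rho' i w = 0].
Proof.
have [N] := ubnP (\sum_(i in S) size (rho i w : {poly F})).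
elim: N x rho => // N IH x rho leN frame killed.
case: (boolP [exists i in S, exists k in S, [&& i != k, rho i w != 0, rho k w != 0 &
   (size (rho k w : {poly F}) <= size (rho i w : {poly F}))%N]]); last first.
  move=> none; have [[i iS]|no] := pselect (exists2 i, i \in S & rho i w != 0); last first.
    exists x, rho, S; split=> // i iS; apply/eqP/negPn/negP => nz; case: no.
    by exists i.
  move=> nz; exists x, rho, (S :\ i); split=> //; first exact: subsetDl.
    by rewrite (cardsD1 i S) iS.
  move=> k; rewrite !inE => /andP[ne_ki kS]; apply/eqP/negPn/negP => nzk.
  case/negP: none; case/orP: (leq_total (size (rho k w : {poly F})) (size (rho i w : {poly F}))) => le.
    apply/exists_inP; exists i => //; apply/exists_inP; exists k => //.
    by rewrite eq_sym ne_ki nz nzk.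
  by apply/exists_inP; exists k => //; apply/exists_inP; exists i; rewrite // ne_ki nz nzk.
case/exists_inP=> i iS /exists_inP[k kS /and4P[ne_ik nzi nzk le_ki]].
have [c [e lt_size]] := euclid_step nzi nzk le_ki.
have [x' frame'] := dual_frame_elementary c e frame ne_ik.
apply: IH frame' _ => [|z j Pz jS].
  rewrite -ltnS (leq_trans _ leN) // ltnS (bigD1 i) //= [X in (_ < X)%N](bigD1 i) //= eqxx.
  rewrite -addSn leq_add // leq_eqVlt; apply/orP; left; apply/eqP/eq_bigr => j /andP[_ ne_ji].
  by rewrite (negPf ne_ji).
case: eqP => [_|_]; last exact: killed.
by rewrite !killed // (lin0 (rlie_hom_linear (ppoly_at_hom pF _))) subr0.
Qed.

(** Each word costs one coordinate. *)
Lemma dual_frame_kill (x : 'I_n -> L) (ws : seq L) : rlie_free_on x -> (size ws < n)%N ->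
  exists x' rho i, dual_frame x' rho /\ forall z, z \in ws -> rho i z = 0.
Proof.
move=> free lt_n; suff [x' [rho [S [frame leS kill]]]] : exists x' rho (S : {set 'I_n}),
    [/\ dual_frame x' rho, (n <= #|S| + size ws)%N
      & forall z i, z \in ws -> i \in S -> rho i z = 0].
  have /card_gt0P[i iS] : (0 < #|S|)%N.
    by rewrite -(ltn_add2r (size ws)) add0n (leq_trans lt_n).
  by exists x', rho, i; split=> // z zw; exact: kill.
elim: ws {lt_n} => [|w ws [x' [rho [S [frame leS kill]]]]].
  have [rho frame] := dual_frame_exists free; exists x, rho, setT; split=> //.
  by rewrite cardsT card_ord addn0.
have [x2 [rho2 [S2 [frame2 sub2 card2 kill2 killw]]]] :=
  @euclid_word S (fun z => z \in ws) w x' rho frame kill.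
exists x2, rho2, S2; split=> //.
  by rewrite addnS -addSn (leq_trans leS) // leq_add2r.
move=> z i; rewrite inE => /predU1P[->|zw] iS2; first exact: killw.
exact/kill2/(subsetP sub2).
Qed.
End Frames.

(** * Cyclic algebras as quotients of the p-polynomials *)
Section CyclicAlgebra.
Variables (p : nat) (F : fieldType).
Hypothesis pF : p \in [pchar F].
Let p_gt1 : (1 < p)%N := prime_gt1 (pcharf_prime pF).
Local Notation R := (ppoly pF).
Local Notation frob := (ppoly_frob pF).

Lemma ppoly_frob_monic (f : {poly F}) e : f \is monic ->
  iter e frob f \is monic /\ size (iter e frob f) = (size f + e)%N.
Proof.
move=> mf; elim: e => [|e [me se]]; first by rewrite addn0.
have ne0 : iter e frob f != 0 by apply: monic_neq0.
rewrite /= /ppoly_frob; split; last by rewrite size_mulX ?map_poly_eq0 // size_map_poly se addnS.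
by rewrite monicMl ?monicX // map_monic.
Qed.

Lemma ppoly_eval_iter_frob (f : {poly F}) e :
  ppoly_eval p (iter e frob f) = ppoly_eval p f ^+ (p ^ e).
Proof.
by elim: e => [|e IH] //=; rewrite ppoly_eval_frob IH -exprM expnSr.
Qed.

Lemma ppoly_at_iter_frob (B : rlieType p F) (a : B) (f : {poly F}) e :
  ppoly_at a f = 0 -> ppoly_at a (iter e frob f) = 0.
Proof.
move=> fa0; elim: e => //= e IH; have [_ _ ha] := ppoly_at_hom pF a.
by rewrite [LHS](ha (iter e frob f)) IH rpow0.
Qed.

(** Division by f on the side that needs no roots: subtract multiples of
iterated p-th powers of f. *)
Lemma ppoly_division (B : rlieType p F) (a : B) (f r : {poly F}) :
  f \is monic -> ppoly_at a f = 0 -> exists s : {poly F},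
  [/\ (size s < size f)%N, ppoly_at a r = ppoly_at a s
    & ppoly_eval p f %| ppoly_eval p (r - s)].
Proof.
move=> mf fa0; have [N] := ubnP (size r); elim: N r => // N IH r le_rN.
have [lt_rf|le_fr] := ltnP (size r) (size f).
  by exists r; split=> //; rewrite subrr (lin0 (@ppoly_eval_linear p F)) dvdp0.
pose e := (size r - size f)%N; have [me se] := ppoly_frob_monic e mf.
pose t := lead_coef r *: iter e frob f.
have r0 : (0 < size r)%N by rewrite (leq_trans _ le_fr) // size_poly_gt0 monic_neq0.
have size_e : size (iter e frob f) = size r by rewrite se subnKC.
have lt_sz : (size (r - t)%R < size r)%N.
  rewrite -(prednK r0) ltnS; apply/leq_sizeP => j; rewrite leq_eqVlt coefB coefZ.
  case/predU1P=> [<-|]; last first.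
    by rewrite prednK // => lt_j; rewrite !nth_default ?size_e // mulr0 subrr.
  by rewrite -{2}size_e -!lead_coefE (monicP me) mulr1 subrr.
have [|s [lt_sf eq_s dv]] := IH (r - t); first exact: leq_trans lt_sz le_rN.
have [la _ _] := ppoly_at_hom pF a.
have ta0 : ppoly_at a t = 0 by rewrite [LHS](linZ la) ppoly_at_iter_frob // scaler0.
exists s; split=> //; first by rewrite -eq_s [RHS](linB la) ta0 subr0.
have -> : r - s = (r - t - s) + t by rewrite addrAC subrK.
rewrite (linD (@ppoly_eval_linear p F)) dvdp_add // (linZ (@ppoly_eval_linear p F)).
by rewrite -mul_polyC dvdp_mull // ppoly_eval_iter_frob dvdp_exp // expn_gt0 ltnW.
Qed.

(** f is the p-polynomial of least degree that kills a generator. *)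
Lemma cyclic_generator (A : rlieVectType p F) : rlie_cyclic A ->
  exists (a : A) (f : {poly F}), [/\ f \is monic, ppoly_at a f = 0,
    forall r, ppoly_at a r = 0 -> ppoly_eval p f %| ppoly_eval p r,
    forall y, exists r : {poly F}, y = ppoly_at a r
    & (\dim (fullv : {vspace A}) <= (size f).-1)%N].
Proof.
case=> a gen_a; have [la ba ra] := ppoly_at_hom pF a.
have surj y : exists r : {poly F}, y = ppoly_at a r.
  pose P z := exists r : {poly F}, z = ppoly_at a r.
  have P0 : P 0 by exists 0; rewrite [RHS](lin0 la).
  have PD c z t : P z -> P t -> P (c *: z + t).
    by case=> [r ->] [s ->]; exists (c *: r + s); rewrite [RHS]la.
  have Pb z t : P z -> P t -> P ⁅z, t⁆.
    by case=> [r ->] [s ->]; exists 0; rewrite [RHS](lin0 la) -[LHS]ba [LHS](lin0 la).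
  have Pp z : P z -> P z^[p].
    by case=> [r ->]; exists (frob r); rewrite [RHS](ra r).
  apply/(in_prop_rsubalg P0 PD Pb Pp)/gen_a/in_prop_rsubalg.
  by exists 'X^0; rewrite ppoly_atXn.
have [f [mf fa0 minf]] : exists f : {poly F}, [/\ f \is monic, ppoly_at a f = 0
    & forall s : {poly F}, ppoly_at a s = 0 -> (size s < size f)%N -> s = 0].
  pose P k := `[< exists r : {poly F}, [/\ r != 0, ppoly_at a r = 0 & size r = k] >].
  have exP : exists k, P k.
    pose d := \dim (fullv : {vspace A}).
    pose X := [tuple iter j (@rpow p F A) a | j < d.+1].
    have /freeP nfree : ~~ free X.
      apply/negP; rewrite /free size_tuple => /eqP dX.
      by have := dimvS (subvf <<X>>%VS); rewrite dX ltnn.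
    have [k [k0 [i ki]]] : exists k : 'I_d.+1 -> F, \sum_i k i *: X`_i = 0 /\ exists i, k i != 0.
      apply: contrapT => no; apply: nfree => k k0 i; apply/eqP/negPn/negP => ki.
      by apply: no; exists k; split=> //; exists i.
    pose r : {poly F} := \poly_(j < d.+1) k (inord j).
    have szr : (size r <= d.+1)%N by exact: size_poly.
    have coefr (j : 'I_d.+1) : r`_j = k j by rewrite coef_poly ltn_ord inord_val.
    exists (size r); apply/asboolP; exists r; split=> //.
      by apply: contra_neq ki => r0; rewrite -coefr r0 coef0.
    rewrite (ppoly_atE a szr) -[RHS]k0; apply: eq_bigr => j _.
    by rewrite coefr (nth_map j) ?size_enum_ord // nth_ord_enum.
  case: (ex_minnP exP) => k /asboolP[r [r0 ra0 szr]] mink.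
  have lr0 : (lead_coef r)^-1 != 0 by rewrite invr_eq0 lead_coef_eq0.
  exists ((lead_coef r)^-1 *: r); split=> [||s sa0].
  - by rewrite monicE lead_coefZ mulVf ?lead_coef_eq0.
  - by rewrite [LHS](linZ la) ra0 scaler0.
  rewrite size_scale // szr ltnNge; case: (eqVneq s 0) => // s0 /negP[].
  by apply: mink; apply/asboolP; exists s.
exists a, f; split=> // [r ra0|].
  have [s [lt_sf eq_s dv]] := ppoly_division r mf fa0.
  by move: dv; rewrite (minf s) ?subr0 // -eq_s.
pose k := (size f).-1; pose X := [tuple iter j (@rpow p F A) a | j < k].
apply: leq_trans (_ : \dim <<X>> <= k)%N; last by rewrite (leq_trans (dim_span _)) ?size_tuple.
apply/dimvS/subvP => y _; have [r ->] := surj y.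
have [s [lt_sf -> _]] := ppoly_division r mf fa0.
have le_sk : (size s <= k)%N by rewrite -ltnS prednK // (leq_ltn_trans _ lt_sf).
rewrite (ppoly_atE a le_sk); apply: memv_suml => j _; apply/memvZ/memv_span.
by apply/mapP; exists j; rewrite ?mem_enum.
Qed.
End CyclicAlgebra.

(** * The linear part of a word *)
Section AbelianJacobson.
Variables (p : nat) (F : fieldType).
Hypothesis pF : p \in [pchar F].
Let p_gt1 : (1 < p)%N := prime_gt1 (pcharf_prime pF).
Variables (T : lieType F) (x c : T).
Hypothesis comm : forall k, (k < p)%N -> ⁅c, iter k (bracket x) c⁆ = 0.

Lemma adcoef_abelian k j : (k.+1 < p)%N ->
  adcoef x c k.+1 j = if j == k then - iter k.+1 (bracket x) c else 0.
Proof.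
elim: k j => [|k IH] j lt_kp.
  case: j => [|[|j]]; rewrite adcoefS /=; first by rewrite add0r bracketC.
    by rewrite bracketxx bracket0r addr0.
  by rewrite !bracket0r addr0.
have {}IH := IH _ (ltnW lt_kp).
rewrite adcoefS !IH (_ : ⁅c, _⁆ = 0) ?addr0; last first.
  by case: eqP => _; rewrite ?bracket0r // bracketNr comm ?oppr0 // ltnW.
by case: j => [|j] //; rewrite IH eqSS; case: eqP; rewrite ?bracketNr ?bracket0r.
Qed.

(** Only the terms of degree one in c survive, and they add up to
(ad x)^(p-1) c. *)
Lemma jacobson_sum_abelian : jacobson_sum p x c = iter p.-1 (bracket x) c.
Proof.
have [k kE] : exists k, p = k.+2 by case: p p_gt1 => [|[|k]] // _; exists k.
have m1 : k.+1%:R = -1 :> F.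
  by apply/eqP; rewrite -subr_eq0 opprK natr1 -kE (pcharf0 pF).
rewrite /jacobson_sum {1}kE big_nat_recr //= big_nat big1 => [|i /andP[i_gt0 lt_ik]].
  rewrite add0r /jacobson_s kE -[k.+2.-1]/k.+1 -[k.+1.-1]/k adcoef_abelian -?kE // eqxx m1 invrN1.
  by rewrite scaleN1r opprK.
rewrite /jacobson_s kE -[k.+2.-1]/k.+1 adcoef_abelian -?kE // -(eqn_add2r 1) !addn1 prednK //.
by rewrite (ltn_eqF lt_ik) scaler0.
Qed.
End AbelianJacobson.

Section SmallJets.
Variables (F : fieldType) (T : lieType F) (n : nat).
Local Notation J := (jets T).
Implicit Types (g : 'I_n -> J) (P Q : 'I_n -> {poly F}).

(** When a word that involves at most K shifts is evaluated on such a family, only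
its linear terms survive. *)
Definition small_jets K g : Prop :=
  (forall i a, (a <= K)%N -> g i a = 0) /\
  (forall i j a b, (a <= K)%N -> (b <= K)%N ->
     ⁅iter a (@shift F T) (g i), iter b (@shift F T) (g j)⁆ = 0).

Lemma small_jetsW K K' g : (K' <= K)%N -> small_jets K g -> small_jets K' g.
Proof.
move=> le_K [g0 gg]; split=> [i a le_a|i j a b le_a le_b].
  by apply: g0; exact: leq_trans le_K.
by apply: gg; exact: leq_trans le_K.
Qed.

Definition jet_comb P g : J := \sum_i poly_shift (P i) (g i).

Lemma poly_shift_sum (P : {poly F}) (u : J) :
  poly_shift P u = \sum_(a < size P) P`_a *: iter a (@shift F T) u.
Proof.
rewrite -{1}[P]coefK poly_def (lin_sum (poly_shift_linearl _)).
by apply: eq_bigr => a _; rewrite (linZ (poly_shift_linearl _)) poly_shiftXn.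
Qed.

Lemma jet_comb_commute K g P Q : small_jets K g ->
  (forall i, (size (P i) <= K)%N) -> (forall i, (size (Q i) <= K)%N) ->
  ⁅jet_comb P g, jet_comb Q g⁆ = 0.
Proof.
move=> [_ gg] sP sQ; rewrite /jet_comb (lin_sum (bracket_linearl _)) big1 // => i _.
rewrite (lin_sum (bracket_linear _)) big1 // => j _; rewrite !poly_shift_sum.
rewrite (lin_sum (bracket_linearl _)) big1 // => a _.
rewrite (lin_sum (bracket_linear _)) big1 // => b _.
rewrite bracketZl bracketZr gg ?scaler0 //.
  exact: ltnW (leq_trans (ltn_ord a) (sP i)).
exact: ltnW (leq_trans (ltn_ord b) (sQ j)).
Qed.

Lemma jet_comb0 K g P : small_jets K g -> (forall i, (size (P i) <= K)%N) ->
  jet_comb P g 0%N = 0.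
Proof.
move=> [g0 _] sP; rewrite [LHS]jet_sum big1 // => i _; rewrite /poly_shift big1 // => a _.
by rewrite add0n g0 ?scaler0 // ltnW // (leq_trans (ltn_ord a)).
Qed.

Lemma poly_shift_comb (Q : {poly F}) P g :
  poly_shift Q (jet_comb P g) = jet_comb (fun i => Q * P i) g.
Proof.
rewrite /jet_comb (lin_sum (poly_shift_linear _)).
by apply: eq_bigr => i _; rewrite poly_shiftM.
Qed.

Lemma jet_combD a P Q g :
  jet_comb (fun i => a *: P i + Q i) g = a *: jet_comb P g + jet_comb Q g.
Proof.
rewrite /jet_comb scaler_sumr -big_split; apply: eq_bigr => i _ /=.
exact: (poly_shift_linearl (g i)).
Qed.

Lemma jet_comb_delta l g : jet_comb (fun i => (i == l)%:R) g = g l.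
Proof.
rewrite /jet_comb (bigD1 l) //= eqxx poly_shift1 big1 ?addr0 // => i /negPf ->.
by rewrite (lin0 (poly_shift_linearl _)).
Qed.
End SmallJets.

Section LinearPart.
Variables (p : nat) (F : fieldType).
Hypothesis pF : p \in [pchar F].
Let p_gt1 : (1 < p)%N := prime_gt1 (pcharf_prime pF).
Local Notation R := (ppoly pF).
Variables (L H : rlieType p F) (n : nat) (x : 'I_n -> L) (i0 : 'I_n) (rho : L -> R).
Hypotheses (free : rlie_free_on x) (hrho : rlie_hom rho).
Hypothesis rho_x : forall l, rho (x l) = if l == i0 then (1 : {poly F}) else 0.
Local Notation J := (jets H).
Local Notation E := (wreath H pF).

(** The words with this property form a restricted subalgebra that contains the
generators: for a bracket the polynomials of w and w' are combined using
rho w and rho w', and for a p-th power they are multiplied by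
(rho w)^(p-1); everything nonlinear in g vanishes once K is large.  The
condition on P i0 says that this polynomial is (rho w) / 'X, so it vanishes
when rho kills w. *)
Lemma linear_part w : exists (K : nat) (P : 'I_n -> {poly F}),
  'X * P i0 = ppoly_eval p (rho w) /\
  forall (g : 'I_n -> J) (Phi : L -> E), small_jets K g -> rlie_hom Phi ->
    (forall l, Phi (x l) = (rho (x l), g l)) -> Phi w = (rho w, jet_comb P g).
Proof.
have [lr br rr] := hrho; have lpp := @ppoly_eval_linear p F.
have sizeP (P : 'I_n -> {poly F}) i : (size (P i) <= \max_j size (P j))%N.
  exact: (@leq_bigmax _ (fun j => size (P j))).
move: w; apply: (free_induction free) => [|a w w' [K [P [XP hP]]] [K' [P' [XP' hP']]]
  |w w' [K [P [XP hP]]] [K' [P' [XP' hP']]]|w [K [P [XP hP]]]|l].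
- exists 0%N, (fun _ => 0); split; first by rewrite (lin0 lr) (lin0 lpp) mulr0.
  move=> g Phi _ [lPhi _ _] _; rewrite (lin0 lPhi) (lin0 lr); congr (_, _).
  by rewrite /jet_comb big1 // => i _; rewrite (lin0 (poly_shift_linearl _)).
- exists (maxn K K'), (fun i => a *: P i + P' i); split.
    by rewrite lr lpp -XP -XP' mulrDr scalerAr.
  move=> g Phi sg hPhi Phix; have [lPhi _ _] := hPhi.
  rewrite lPhi lr (hP g) ?(hP' g) ?jet_combD //.
    by apply: small_jetsW sg; rewrite leq_maxr.
  by apply: small_jetsW sg; rewrite leq_maxl.
- pose M := maxn (\max_j size (P j)) (\max_j size (P' j)).
  exists (maxn M (maxn K K')), (fun i =>
    (-1) *: (ppoly_eval p (rho w') * P i) + ppoly_eval p (rho w) * P' i); split.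
    rewrite br (lin0 lpp) scaleN1r mulrDr mulrN mulrCA XP mulrCA XP'.
    by rewrite mulrC addNr.
  move=> g Phi sg hPhi Phix; have [_ bPhi _] := hPhi.
  rewrite bPhi (hP g) ?(hP' g) //; last 2 first.
  + by apply: small_jetsW sg; rewrite !leq_max leqnn !orbT.
  + by apply: small_jetsW sg; rewrite !leq_max leqnn !orbT.
  rewrite br wreathE /=; congr (_, _); rewrite jet_combD -!poly_shift_comb scaleN1r.
  rewrite (jet_comb_commute sg) ?addr0 1?addrC // => i.
    by rewrite !leq_max sizeP.
  by rewrite !leq_max sizeP orbT.
- pose M k := \max_j size (ppoly_eval p (rho w) ^+ k * P j)%R.
  exists (maxn (\max_(k < p.+1) M k) (maxn K (\max_j size ('X * P j)%R))),
    (fun i => ppoly_eval p (rho w) ^+ p.-1 * P i); split.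
    rewrite mulrCA XP -exprSr prednK ?(ltnW p_gt1) // rr.
    exact/esym/ppoly_eval_frob.
  move=> g Phi sg hPhi Phix; have [_ _ rPhi] := hPhi.
  rewrite rPhi (hP g) //; last by apply: small_jetsW sg; rewrite !leq_max leqnn !orbT.
  rewrite wreath_rpowE /=; set c := jet_comb P g.
  have sM k i : (k < p.+1)%N -> (size (ppoly_eval p (rho w) ^+ k * P i)%R <=
      maxn (\max_(k < p.+1) M k) (maxn K (\max_j size ('X * P j)%R)))%N.
    move=> lt_k; rewrite leq_max (leq_trans (sizeP (fun i => _ ^+ k * P i) i)) //.
    exact: (@leq_bigmax _ (fun k : 'I_p.+1 => M k) (Ordinal lt_k)).
  have sP i : (size (P i) <=
      maxn (\max_(k < p.+1) M k) (maxn K (\max_j size ('X * P j)%R)))%N.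
    by have := sM 0%N i isT; rewrite expr0 mul1r.
  have c0 : c 0%N = 0.
    exact: (jet_comb0 sg).
  have cc k : (k < p)%N -> ⁅c, poly_shift (ppoly_eval p (rho w) ^+ k) c⁆ = 0.
    move=> lt_kp; rewrite poly_shift_comb (jet_comb_commute sg) // => i.
    exact/sM/ltnW.
  have -> : jet_rpow c = 0.
    apply: jet_eqP; case=> [|l]; first by rewrite /jet_rpow c0 rpow0.
    rewrite /jet_rpow /ad_pred; have -> : p.-1 = p.-2.+1 by case: p p_gt1 => [|[]].
    rewrite iterSr (_ : ⁅c, shift c⁆ = 0) ?(lin0 (iter_bracket_linear _ _)) //.
    rewrite -[shift c]/(iter 1 (@shift F H) c) -poly_shiftXn expr1 poly_shift_comb.
    rewrite (jet_comb_commute sg) // => i.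
    by rewrite !leq_max (sizeP (fun i => 'X * P i)) !orbT.
  rewrite (jacobson_sum_abelian pF) => [|k lt_kp]; last first.
    by rewrite iter_bracket_top_base -(lie_hom_bracket (base_hom _ _)) cc.
  rewrite iter_bracket_top_base poly_shift_comb rr.
  by congr (_, _); rewrite /= ?addr0 ?add0r.
- exists 0%N, (fun i => (i == l)%:R); split.
    rewrite rho_x eq_sym; case: eqP => _; last by rewrite mulr0 (lin0 lpp).
    by rewrite mulr1 -(expr0 'X) ppoly_evalXn expn0 expr1.
  by move=> g Phi _ _ ->; rewrite jet_comb_delta.
Qed.
End LinearPart.

(** * Linear recurrences *)
Section CommonZero.
Variables (F : fieldType) (U : vectType F) (I : finType) (e : I -> U -> F^o).
Hypothesis le : forall i, linear (e i).

Let eval (u : U) : {ffun I -> F^o} := [ffun i => e i u].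
Fact common_eval_linear : linear eval.
Proof. by move=> a u v; apply/ffunP => i; rewrite !ffunE le. Qed.
HB.instance Definition _ := GRing.isLinear.Build F U {ffun I -> F^o} *:%R eval common_eval_linear.

Lemma common_zero : (#|I| < \dim (fullv : {vspace U}))%N ->
  exists u, u != 0 /\ forall i, e i u = 0.
Proof.
move=> lt_I; pose f := linfun eval.
have leI : (\dim (f @: fullv) <= #|I|)%N.
  by rewrite (leq_trans (dimvS (subvf _))) // dimvf /dim /= muln1.
have := limg_ker_dim f fullv; rewrite capfv => dimE.
have ker0 : lker f != 0%VS.
  by apply: contraTneq lt_I => k0; rewrite -leqNgt -dimE k0 dimv0.
exists (vpick (lker f)); split; first by rewrite vpick0.
move=> i; have := memv_pick (lker f); rewrite memv_ker lfunE /= => /eqP/ffunP/(_ i).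
by rewrite !ffunE.
Qed.
End CommonZero.

Section Recurrence.
Variables (F : fieldType) (f : {poly F}) (q : nat).
Hypotheses (mf : f \is monic) (sf : size f = q.+1).

Lemma recurrence_eq0 (T : lieType F) (u : jets T) :
  poly_shift f u = 0 -> (forall l, (l < q)%N -> u l = 0) -> u = 0.
Proof.
move=> fu u0; apply: jet_eqP => l; have [N] := ubnP l; elim: N l => // N IH l lt_lN.
have [/u0 //|le_ql] := ltnP l q.
have := congr1 (fun v : jets T => v (l - q)%N) fu.
rewrite /poly_shift sf big_ord_recr /= subnK //.
have -> : f`_q = 1 by rewrite -(monicP mf) lead_coefE sf.
rewrite scale1r big1 ?add0r // => i _; rewrite IH ?scaler0 //.
by rewrite (leq_trans _ (ltnSE lt_lN)) // -[X in (_ < X)%N](subnK le_ql) ltn_add2l.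
Qed.

(** A sequence satisfying the recurrence f is l |-> phi ('X^l) for a linear form phi
on polynomials modulo f; v is the tuple of the first q values, hence the
coordinates of phi. *)
Definition residue_pairing (v : 'I_q -> F) (P : {poly F}) : F := \sum_k v k * (P %% f)`_k.
Definition residue_jet (T : lieType F) (v : 'I_q -> F) (z : T) : jets T :=
  fun l => residue_pairing v 'X^l *: z.

Lemma residue_pairing_linear v : linear (residue_pairing v : {poly F} -> F^o).
Proof.
move=> a P Q; rewrite /residue_pairing scaler_sumr -big_split /=; apply: eq_bigr => k _.
by rewrite modpD modpZl coefD coefZ mulrDr mulrCA.
Qed.

Lemma residue_jet_small (T : lieType F) v (z : T) (l : 'I_q) : residue_jet v z l = v l *: z.
Proof.
rewrite /residue_jet /residue_pairing modp_small ?size_polyXn ?sf //; last first.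
  by rewrite ltnS.
rewrite (bigD1 l) //= coefXn eqxx mulr1 big1 ?addr0 // => k ne_kl.
by rewrite coefXn (negPf (_ : (k != l :> nat))) ?mulr0.
Qed.

Lemma poly_shift_residue (T : lieType F) v (z : T) P l :
  poly_shift P (residue_jet v z) l = residue_pairing v ('X^l * P) *: z.
Proof.
have lp := residue_pairing_linear v.
rewrite -[in RHS](coefK P) poly_def mulr_sumr (lin_sum lp) scaler_suml.
apply: eq_bigr => i _; rewrite -scalerAr (linZ lp) -exprD.
by rewrite /residue_jet scalerA.
Qed.

Lemma residue_jet_recurrence (T : lieType F) v (z : T) : poly_shift f (residue_jet v z) = 0.
Proof.
apply: jet_eqP => l; rewrite poly_shift_residue /residue_pairing big1 ?scale0r // => k _.
by rewrite modp_mull coef0 mulr0.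
Qed.

(** There are n q unknowns, and q + n K + m q equations: the row i0 is zero, the
first K entries of every row are zero, and the m sequences attached to the P j vanish,
which by the recurrence is a matter of their first q terms. *)
Lemma residue_system (n m K : nat) (P : 'I_m -> 'I_n -> {poly F}) (i0 : 'I_n) :
  (m + 2 <= n)%N -> (n * K < q)%N -> exists v : 'I_n -> 'I_q -> F,
  [/\ exists i k, v i k != 0, forall k, v i0 k = 0,
      forall i (k : 'I_q), (k < K)%N -> v i k = 0
    & forall j (l : 'I_q), \sum_i residue_pairing (v i) ('X^l * P j i) = 0].
Proof.
move=> le_mn lt_nKq.
have n_gt0 : (0 < n)%N by rewrite (leq_trans _ le_mn) // addn2.
have leKq : (K <= q)%N by rewrite (leq_trans (leq_pmull K n_gt0)) // ltnW.
pose I : finType := ('I_q + 'I_n * 'I_K + 'I_m * 'I_q)%type.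
pose e (i : I) (v : 'M[F]_(n, q)) : F^o := match i with
  | inl (inl k) => v i0 k
  | inl (inr (i, k)) => v i (widen_ord leKq k)
  | inr (j, l) => \sum_i residue_pairing (v i) ('X^l * P j i)
  end.
have le i : linear (e i).
  move=> a u v; case: i => [[k|[i k]]|[j l]] /=; rewrite ?mxE //.
  rewrite scaler_sumr -big_split /=; apply: eq_bigr => i _.
  rewrite /residue_pairing scaler_sumr -big_split /=; apply: eq_bigr => k _.
  by rewrite !mxE mulrDl scalerAl.
have [|v [v0 ev]] := common_zero le.
  rewrite dimvf /dim /= !card_sum !card_prod !card_ord.
  rewrite (@leq_trans (q + q + m * q)%N) //; first by rewrite ltn_add2r ltn_add2l.
  by rewrite addnn -mul2n -mulnDl leq_mul2r addnC le_mn orbT.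
exists (fun i k => v i k); split=> [|k|i k lt_kK|j l].
- apply: contrapT => no; case/eqP: v0; apply/matrixP => i k; rewrite mxE.
  by apply/eqP/negPn/negP => vik; apply: no; exists i, k.
- exact: (ev (inl (inl k))).
- have := ev (inl (inr (i, Ordinal lt_kK))); rewrite /e /= => <-; congr (v i _).
  exact/val_inj.
- exact: (ev (inr (j, l))).
Qed.
End Recurrence.

(** * Kernels, quotients and free algebras of rank two *)
Section Quotients.
Variables (p : nat) (F : fieldType).
Implicit Types L H K G A : rlieType p F.

Section Kernel.
Variables (L K : rlieType p F) (f : L -> K).
Hypothesis pF : p \in [pchar F].
Hypothesis hf : rlie_hom f.

Fact hom_kernel_submod : submod_closed [pred x | f x == 0].
Proof.
have lf := rlie_hom_linear hf; split=> [|a x y]; rewrite !inE ?(lin0 lf) //.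
by move=> /eqP fx /eqP fy; rewrite lf fx fy scaler0 addr0.
Qed.
Fact hom_kernel_bracket x : {in [pred x | f x == 0], forall y, ⁅x, y⁆ \in [pred x | f x == 0]}.
Proof.
by move=> y; rewrite !inE => /eqP fy; rewrite (rlie_hom_bracket hf) fy bracket0r.
Qed.
Fact hom_kernel_rpow : {in [pred x | f x == 0], forall x, x^[p] \in [pred x | f x == 0]}.
Proof.
by move=> x; rewrite !inE => /eqP fx; rewrite (rlie_hom_rpow hf) fx (rpow0 pF).
Qed.
Definition hom_kernel : rideal L :=
  RIdeal hom_kernel_submod hom_kernel_bracket hom_kernel_rpow.
Lemma in_hom_kernel x : (x \in hom_kernel) = (f x == 0).
Proof. by []. Qed.

Lemma rideal_gen_killed T (w : T -> L) : (forall i, f (w i) = 0) ->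
  forall x, x \in rideal_gen w -> f x = 0.
Proof.
move=> fw x /asboolP/(_ hom_kernel) wx; apply/eqP; rewrite -in_hom_kernel.
by apply: wx => i; rewrite in_hom_kernel fw.
Qed.

Lemma quotient_lift (I : rideal L) : (forall x, x \in I -> f x = 0) ->
  exists g : rquot I -> K, rlie_hom g /\ forall x, g (rquot_pi I x) = f x.
Proof.
move=> fI; have [lf bf rf] := hf; pose g (u : rquot I) := f (repr u).
have gE x : g (rquot_pi I x) = f x.
  by rewrite /g; have [m mI ->] := repr_rquot I x; rewrite (linD lf) (fI m) ?addr0.
have [lq bq rq] := rquot_pi_hom I; exists g; split=> //; split.
- move=> a u v; elim/rquot_ind: u => x; elim/rquot_ind: v => y.
  by rewrite -[a *: _ + _]lq !gE lf.
- move=> u v; elim/rquot_ind: u => x; elim/rquot_ind: v => y.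
  by rewrite -[⁅_, _⁆ in LHS]bq !gE bf.
- move=> u; elim/rquot_ind: u => x.
  by rewrite -[_^[p] in LHS]rq !gE rf.
Qed.

Lemma quotient_kernel_isom : (forall y, exists x, f x = y) -> rlie_isom (rquot hom_kernel) K.
Proof.
move=> surj; have [|g [hg gE]] := @quotient_lift hom_kernel.
  by move=> x; rewrite in_hom_kernel => /eqP.
exists g; split=> //; have [lg _ _] := hg.
have ginj : injective g.
  move=> u v; elim/rquot_ind: u => x; elim/rquot_ind: v => y; rewrite !gE => fxy.
  by apply/rquotP; rewrite in_hom_kernel (linB (rlie_hom_linear hf)) fxy subrr.
have /choice[h hh] y : exists u, g u = y.
  by have [x <-] := surj y; exists (rquot_pi hom_kernel x).
by exists h => [u|y]; [apply: ginj|].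
Qed.
End Kernel.

Lemma rlie_hom_inverse L K (f : L -> K) g : rlie_hom f -> cancel f g -> cancel g f -> rlie_hom g.
Proof.
move=> [lf bf rf] fK gK; split=> [a x y|x y|x]; apply: (can_inj fK).
- by rewrite gK lf !gK.
- by rewrite gK bf !gK.
- by rewrite gK rf !gK.
Qed.

(** Kill all generators but two. *)
Lemma free_rank_two (pF : p \in [pchar F]) L n (x : 'I_n -> L) : rlie_free_on x -> (1 < n)%N ->
  exists (H : rlieType p F) (y : bool -> H), rlie_free_on y.
Proof.
move=> free n_gt1; pose i := Ordinal n_gt1; pose j := Ordinal (ltnW n_gt1).
have ne_ij : i != j by [].
pose w k := if (k == i) || (k == j) then 0 else x k.
pose q := rquot_pi (rideal_gen w).
have hq : rlie_hom q by exact: rquot_pi_hom.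
exists (rquot (rideal_gen w)), (fun b : bool => if b then q (x i) else q (x j)).
move=> K h; have [f [hf fx uniq]] :=
  free K (fun k => if k == i then h true else if k == j then h false else 0).
have fw k : f (w k) = 0.
  rewrite /w; have [_|ki] := eqVneq k i; first exact: (lin0 (rlie_hom_linear hf)).
  have [_|kj] := eqVneq k j; first exact: (lin0 (rlie_hom_linear hf)).
  by rewrite fx (negPf ki) (negPf kj).
have [g [hg gE]] := quotient_lift hf (rideal_gen_killed pF hf fw).
exists g; split=> // [[]|g' hg' g'y].
- by rewrite gE fx eqxx.
- by rewrite gE fx eqxx eq_sym (negPf ne_ij).
elim/rquot_ind=> z; rewrite gE; apply: (uniq (fun z => g' (q z))); first exact: rlie_hom_comp.
move=> k; case: eqP => [->|/eqP ki]; first exact: (g'y true).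
case: eqP => [->|/eqP kj]; first exact: (g'y false).
have -> : q (x k) = 0.
  have -> : 0 = q 0 by rewrite (lin0 (rlie_hom_linear hq)).
  apply/rquotP; rewrite subr0; apply/asboolP => J /(_ k).
  by rewrite /w (negPf ki) (negPf kj).
exact: (lin0 (rlie_hom_linear hg')).
Qed.

(** The two elementary nilpotent matrices of size 2 do not commute. *)
Lemma free_rank_two_nonabelian (pF : p \in [pchar F]) H (y : bool -> H) :
  rlie_free_on y -> ~ rlie_abelian H.
Proof.
move=> free ab.
pose Q := commutator_lie 'M[F]_2 pF.
have [f [hf fy _]] := free Q (fun b => if b then delta_mx 0 1 : 'M[F]_2 else delta_mx 1 0).
have : f ⁅y true, y false⁆ = 0 by rewrite ab (lin0 (rlie_hom_linear hf)).
rewrite (rlie_hom_bracket hf) !fy => /matrixP/(_ 0 0)/eqP.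
rewrite /bracket /= /commutator !mxE !big_ord_recl !big_ord0 !mxE /=.
by rewrite !mulr1 !mulr0 !addr0 add0r subr0 oner_eq0.
Qed.
End Quotients.

(** * Homomorphisms from the free algebra to the wreath product *)
Section WreathGenerators.
Variables (p : nat) (F : fieldType).
Hypothesis pF : p \in [pchar F].
Let p_gt1 : (1 < p)%N := prime_gt1 (pcharf_prime pF).
Let p_gt0 : (0 < p)%N := ltnW p_gt1.
Variable H : rlieType p F.
Local Notation J := (jets H).
Local Notation E := (wreath H pF).
Implicit Types (u g : J) (r f : {poly F}).

(** The terms of g commute and its first p^d - 1 terms vanish, so the p-th power of
the jet part is zero for j < d and only (ad 'X^j)^(p-1) contributes: the exponents
of the shift add up as (p^j - 1) + p^j (p - 1) = p^(j+1) - 1. *)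
Lemma iter_rpow_generator g d j : (forall i k, ⁅g i, g k⁆ = 0) ->
  (forall l, (l < (p ^ d).-1)%N -> g l = 0) -> (j <= d)%N ->
  iter j (@rpow p F E) (1 : {poly F}, g) =
    ('X^j : {poly F}, iter (p ^ j).-1 (@shift F H) g) :> E.
Proof.
move=> gg g0; elim: j => [|j IH] le_jd; first by rewrite expr0.
have pj_gt0 k : (0 < p ^ k)%N by rewrite expn_gt0 p_gt0.
rewrite iterS IH ?(ltnW le_jd) // wreath_rpowE /=; set c := iter _ _ g.
have cE l : c l = g (l + (p ^ j).-1)%N by exact: iter_shiftE.
have shift_cc k : ⁅c, iter k (@shift F H) c⁆ = 0.
  apply: jet_bracket_commuting => a b; rewrite cE.
  by rewrite [X in ⁅_, X⁆](iter_shiftE k c b) cE.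
have -> : jet_rpow c = 0.
  apply: jet_eqP; case=> [|l].
    have lt_j : ((p ^ j).-1 < (p ^ d).-1)%N by rewrite -ltnS !prednK // ltn_exp2l.
    by rewrite /jet_rpow cE add0n g0 // (rpow0 pF).
  rewrite /jet_rpow /ad_pred; have -> : p.-1 = p.-2.+1 by case: p p_gt1 => [|[]].
  by rewrite iterSr (shift_cc 1%N) (lin0 (iter_bracket_linear _ _)).
have powE k : ppoly_eval p ('X^j : {poly F}) ^+ k = 'X^(p ^ j * k).
  by rewrite ppoly_evalXn -exprM.
rewrite (jacobson_sum_abelian pF) => [|k lt_kp]; last first.
  rewrite iter_bracket_top_base -(lie_hom_bracket (base_hom _ _)) powE poly_shiftXn.
  by rewrite shift_cc.
rewrite iter_bracket_top_base powE poly_shiftXn ppoly_frobXn.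
congr (_, _); rewrite /= ?addr0 // !add0r -iterD; congr (iter _ _ g).
apply: succn_inj; rewrite -addnS !prednK // -mulnSr prednK // expnSr //.
Qed.

(** Among the powers of the shift applied to g only the last one has a nonzero 0-th
term. *)
Lemma ppoly_at_generator g f d : f \is monic -> size f = d.+1 ->
  (forall i k, ⁅g i, g k⁆ = 0) -> (forall l, (l < (p ^ d).-1)%N -> g l = 0) ->
  (ppoly_at ((1 : {poly F}, g) : E) f).2 0%N = g (p ^ d).-1.
Proof.
move=> mf sf gg g0; rewrite /ppoly_at.
have lin : linear (fun X : E => X.2 0%N : H) by [].
rewrite (lin_sum lin) sf big_ord_recr /= big1 ?add0r => [|j _].
  rewrite (iter_rpow_generator gg g0) //=; have -> : f`_d = 1.
    by rewrite -(monicP mf) lead_coefE sf.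
  by rewrite scale1r iter_shiftE.
rewrite (iter_rpow_generator gg g0) 1?ltnW //= jetZ iter_shiftE add0n g0 ?scaler0 //.
by rewrite -ltnS !prednK ?expn_gt0 ?p_gt0 // ltn_exp2l.
Qed.

(** The first q terms of g vanish, so that up to this order bracketing
with (1, g) is the shift. *)
Lemma iter_bracket_generator g u q k : (forall l, (l < q)%N -> g l = 0) -> exists c : J,
  iter k (bracket ((1 : {poly F}, g) : E)) (base pF u) = base pF c /\
  forall l, (l + k <= q)%N -> c l = u (l + k)%N.
Proof.
move=> g0; elim: k => [|k [c [cE cl]]]; first by exists u; split=> // l _; rewrite addn0.
exists (shift c + ⁅g, c⁆); split.
  rewrite iterS cE wreathE /= (lin0 (ppoly_shift_linearl _)) subr0.
  by rewrite /ppoly_shift -(expr0 'X) ppoly_evalXn poly_shiftXn.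
move=> l le_lq; rewrite jetD (@jet_bracket_vanish _ _ q 0) // ?addn0.
  by rewrite addr0 /shift cl addSnnS.
by rewrite (leq_trans _ le_lq) // addnS ltnS leq_addr.
Qed.

Lemma rlie_hom_ppoly_at (B C : rlieType p F) (h : B -> C) b r :
  rlie_hom h -> h (ppoly_at b r) = ppoly_at (h b) r.
Proof.
move=> hh; have lh := rlie_hom_linear hh; rewrite /ppoly_at (lin_sum lh).
by apply: eq_bigr => j _; rewrite (linZ lh) (rlie_hom_iter_rpow _ _ hh).
Qed.

Lemma centralizer_rpow (K : rlieType p F) (t x : K) : ⁅t, x⁆ = 0 -> ⁅t, x^[p]⁆ = 0.
Proof.
move=> tx; rewrite bracketC bracket_rpow.
have -> : iter p (bracket x) t = iter p.-1 (bracket x) ⁅x, t⁆ by rewrite -iterSr prednK.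
by rewrite bracketC tx oppr0 (lin0 (iter_bracket_linear _ _)) oppr0.
Qed.

Lemma size_ppoly_eval f d : f \is monic -> size f = d.+1 ->
  size (ppoly_eval p f) = (p ^ d).+1 /\ ppoly_eval p f \is monic.
Proof.
move=> mf sf; have fd : f`_d = 1 by rewrite -(monicP mf) lead_coefE sf.
have E : ppoly_eval p f = 'X^(p ^ d) + \sum_(j < d) f`_j *: 'X^(p ^ j).
  by rewrite /ppoly_eval sf big_ord_recr /= fd scale1r addrC.
have lt_s : (size (\sum_(j < d) f`_j *: 'X^(p ^ j))%R < size ('X^(p ^ d) : {poly F}))%N.
  rewrite size_polyXn ltnS; apply: (leq_trans (size_sum _ _ _)).
  apply/bigmax_leqP => j _; rewrite (leq_trans (size_scale_leq _ _)) // size_polyXn.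
  by rewrite ltn_exp2l.
by rewrite E size_polyDl // size_polyXn monicE lead_coefDl // lead_coefXn.
Qed.
End WreathGenerators.

Section WreathHom.
Variables (p : nat) (F : fieldType).
Hypothesis pF : p \in [pchar F].
Let p_gt1 : (1 < p)%N := prime_gt1 (pcharf_prime pF).
Let p_gt0 : (0 < p)%N := ltnW p_gt1.
Local Notation R := (ppoly pF).
Variables (L H : rlieType p F) (n m : nat) (x : 'I_n -> L) (i0 : 'I_n) (rho : L -> R).
Hypotheses (free : rlie_free_on x) (hrho : rlie_hom rho).
Hypothesis rho_x : forall l, rho (x l) = if l == i0 then (1 : {poly F}) else 0.
Local Notation J := (jets H).
Local Notation E := (wreath H pF).
Variables (w : 'I_m -> L) (K : nat) (P : 'I_m -> 'I_n -> {poly F}).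
Hypothesis rho_w : forall j, rho (w j) = 0.
Hypothesis P_i0 : forall j, P j i0 = 0.
Hypothesis w_linear : forall j (g : 'I_n -> J) (Phi : L -> E), small_jets K g ->
  rlie_hom Phi -> (forall l, Phi (x l) = (rho (x l), g l)) ->
  Phi (w j) = (rho (w j), jet_comb (P j) g).
Hypothesis le_mn : (m + 2 <= n)%N.
Variables (y z : H) (f : {poly F}) (d : nat).
Hypotheses (mf : f \is monic) (sf : size f = d.+1) (large_d : (n * (K + K).+1 < d)%N).

(** The jet g i0 is the solution of the recurrence with first q values 0, ..., 0, y,
and the other g i are the multiples of z given by [residue_system]. *)
Lemma wreath_hom_exists : exists Phi : L -> E,
  [/\ rlie_hom Phi, forall l, (Phi l).1 = rho l, forall j, Phi (w j) = 0,
      forall l, ⁅top pF H f, Phi l⁆ = 0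
    & (Phi (ppoly_at (x i0) f)).2 0%N = y /\
      exists l c, [/\ rho l = 0, c != 0 & (Phi l).2 0%N = c *: z]].
Proof.
set q := (p ^ d)%N; have q_gt0 : (0 < q)%N by rewrite expn_gt0 p_gt0.
have [sq mq] := size_ppoly_eval pF mf sf; rewrite -/q in sq.
have n_gt0 : (0 < n)%N by rewrite (leq_trans _ le_mn) // addn2.
have lt_dq : (d < q)%N by exact: ltn_expl.
have lt_nq : (n * (K + K).+1 < q)%N by exact: ltn_trans lt_dq.
have lt_Kq : (K + K < q.-1)%N.
  by rewrite -ltnS prednK // (leq_ltn_trans _ lt_nq) // leq_pmull.
have le_K : (K <= K + K)%N by exact: leq_addr.
set M := ppoly_eval p f in sq mq.
have [v [[i1 [k1 vik]] v0 vK vP]] := residue_system M P i0 le_mn lt_nq.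
have ne_i1 : i1 != i0 by apply: contra_neq vik => ->.
pose b (k : 'I_q) : F := (k == q.-1 :> nat)%:R.
pose g i : J := if i == i0 then residue_jet M b y else residue_jet M (v i) z.
have lt_qq : (q.-1 < q)%N by rewrite prednK.
have b_low l : (l < q.-1)%N -> g i0 l = 0.
  move=> lt_l; have lt_lq := ltn_trans lt_l lt_qq.
  rewrite /g eqxx -[l]/(nat_of_ord (Ordinal lt_lq)) residue_jet_small //.
  by rewrite /b /= (ltn_eqF lt_l) scale0r.
have b_top : g i0 q.-1 = y.
  rewrite /g eqxx -[q.-1]/(nat_of_ord (Ordinal lt_qq)) residue_jet_small //.
  by rewrite /b /= eqxx scale1r.
have gv i (l : 'I_q) : i != i0 -> g i l = v i l *: z.
  by move=> ne_i; rewrite /g (negPf ne_i) residue_jet_small.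
have g_low i l : i != i0 -> (l < (K + K).+1)%N -> g i l = 0.
  move=> ne_i lt_l; have lt_lq : (l < q)%N.
    by rewrite (leq_trans lt_l) // (leq_trans lt_Kq) // leq_pred.
  by rewrite (gv i (Ordinal lt_lq)) // vK // scale0r.
have g_rec i : poly_shift M (g i) = 0.
  by rewrite /g; case: eqP => _; apply: residue_jet_recurrence.
have iter_rec k (u : J) : poly_shift M u = 0 -> poly_shift M (iter k (@shift F H) u) = 0.
  rewrite -poly_shiftXn -poly_shiftM mulrC poly_shiftM => ->.
  exact: (lin0 (poly_shift_linear _)).
have g_par i j a c : (i == i0) = (j == i0) -> ⁅g i a, g j c⁆ = 0.
  rewrite /g => ->; case: ifP => _; rewrite /residue_jet bracketZl bracketZr bracketxx !scaler0 //.
have cross a c j : j != i0 -> (a <= K)%N -> (c <= K)%N ->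
    ⁅iter a (@shift F H) (g i0), iter c (@shift F H) (g j)⁆ = 0.
  move=> ne_j le_a le_c; apply: (recurrence_eq0 mq sq).
    rewrite -[poly_shift M _]/(ppoly_shift p f _).
    rewrite (derivation_bracket (ppoly_shift_derivation pF H f)).
    rewrite [ppoly_shift _ _ _]iter_rec // [ppoly_shift _ _ _]iter_rec //.
    by rewrite bracket0l bracket0r addr0.
  (* The orders of vanishing add up to at least q - 1 - a + 2 K + 1 - c >= q. *)
  move=> l lt_lq; apply: (@jet_bracket_vanish _ _ (q.-1 - a) ((K + K).+1 - c)).
  - by move=> i lt_i; rewrite iter_shiftE b_low // addnC -ltn_subRL.
  - by move=> i lt_i; rewrite iter_shiftE g_low // addnC -ltn_subRL.
  have le_aq : (a <= q.-1)%N by rewrite ltnW // (leq_ltn_trans le_a) // (leq_ltn_trans le_K).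
  apply: (leq_trans lt_lq); rewrite -(leq_add2r (a + c)) addnACA subnK // subnK.
    by rewrite addnS -addSn prednK // leq_add2l leq_add.
  by rewrite ltnW // ltnS (leq_trans le_c).
have small : small_jets K g.
  split=> [i a le_a|i j a c le_a le_c].
    have [->|ne_i] := eqVneq i i0; last by rewrite g_low // ltnS (leq_trans le_a).
    by rewrite b_low // (leq_ltn_trans le_a) // (leq_ltn_trans le_K).
  have [e_i|ne_i] := eqVneq i i0; have [e_j|ne_j] := eqVneq j i0.
  - by apply: jet_bracket_commuting => s t; rewrite !iter_shiftE g_par // e_i e_j.
  - by rewrite e_i cross.
  - by rewrite bracketC e_j cross // oppr0.
  by apply: jet_bracket_commuting => s t; rewrite !iter_shiftE g_par // (negPf ne_i) (negPf ne_j).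
have [Phi [hPhi Phix _]] := free (fun l => (rho (x l), g l) : E).
have [lPhi bPhi _] := hPhi.
have Phi1 l : (Phi l).1 = rho l.
  have [r [hr rx uniq]] := free (fun l => rho (x l)).
  rewrite (uniq rho) // (uniq (fun l => (Phi l).1)) // => [|k]; last by rewrite Phix.
  exact: (rlie_hom_comp (fst_wreath_hom pF H) hPhi).
exists Phi; split=> //.
- move=> j; rewrite (w_linear j small hPhi Phix) rho_w; congr (_, _).
  apply: (recurrence_eq0 mq sq).
    rewrite poly_shift_comb /jet_comb big1 // => i _.
    by rewrite mulrC poly_shiftM g_rec (lin0 (poly_shift_linear _)).
  move=> l lt_lq; rewrite [LHS]jet_sum.
  transitivity ((\sum_i residue_pairing M (v i) ('X^l * P j i)) *: z); last first.
    by rewrite (vP j (Ordinal lt_lq)) scale0r.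
  rewrite scaler_suml; apply: eq_bigr => i _; have [->|ne_i] := eqVneq i i0.
    rewrite P_i0 (lin0 (poly_shift_linearl _)) /residue_pairing big1 ?scale0r // => k _.
    by rewrite v0 mul0r.
  by rewrite /g (negPf ne_i) poly_shift_residue.
- (* Elements killed by f form the centralizer of (f, 0), a restricted subalgebra. *)
  apply: (free_induction free) => [|c l l' hl hl'|l l' hl hl'|l hl|l].
  + by rewrite (lin0 lPhi) bracket0r.
  + by rewrite lPhi bracketDr bracketZr hl hl' scaler0 addr0.
  + have := bracket_jacobi (top pF H f) (Phi l) (Phi l').
    by rewrite bPhi [⁅Phi l', _⁆]bracketC hl hl' oppr0 !bracket0r !addr0.
  + by rewrite (rlie_hom_rpow hPhi) centralizer_rpow.
  rewrite Phix wreathE /= bracket0l addr0 (lin0 (ppoly_shift_linear _)) subr0.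
  by rewrite [ppoly_shift _ _ _]g_rec.
split.
  rewrite (rlie_hom_ppoly_at _ _ hPhi) Phix rho_x eqxx.
  rewrite (ppoly_at_generator pF mf sf) ?b_top // => i k; exact: g_par.
have [c [cE cl]] := iter_bracket_generator pF (g i1) k1 b_low.
exists (iter k1 (bracket (x i0)) (x i1)), (v i1 k1); split=> //.
  have rho1 : rho (x i1) = 0 by rewrite rho_x (negPf ne_i1).
  rewrite (lie_hom_iter (rlie_lie_hom hrho)) rho1.
  exact: (lin0 (iter_bracket_linear _ _)).
rewrite (lie_hom_iter (rlie_lie_hom hPhi)) !Phix !rho_x eqxx (negPf ne_i1) [iter _ _ _]cE /=.
by rewrite cl ?add0n ?gv // -ltnS prednK.
Qed.
End WreathHom.

(** * Mapping the kernel onto a free algebra *)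
Section Evaluation.
Variables (p : nat) (F : fieldType).
Hypothesis pF : p \in [pchar F].
Let p_gt1 : (1 < p)%N := prime_gt1 (pcharf_prime pF).
Variables (G H A : rlieType p F).
Local Notation E := (wreath H pF).
Variables (theta : G -> E) (a : A) (f : {poly F}).
Hypotheses (htheta : rlie_hom theta) (fa0 : ppoly_at a f = 0).
Hypothesis f_min : forall r, ppoly_at a r = 0 -> ppoly_eval p f %| ppoly_eval p r.
Hypothesis f_central : forall g, ⁅top pF H f, theta g⁆ = 0.

Definition cyclic_projection (g : G) : A := ppoly_at a (theta g).1.

Lemma cyclic_projection_hom : rlie_hom cyclic_projection.
Proof.
have h1 := rlie_hom_comp (fst_wreath_hom pF H) htheta.
exact: (rlie_hom_comp (ppoly_at_hom pF a) h1).
Qed.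

Local Notation M := (hom_kernel pF cyclic_projection_hom).

Definition kernel_value (u : rsub (rideal_rsubalg M)) : H := (theta (rsub_val u)).2 0%N.

(** Elements of M have a first component divisible by f, which acts as zero. *)
Lemma kernel_shift0 (u u' : rsub (rideal_rsubalg M)) :
  ppoly_shift p (theta (rsub_val u)).1 (theta (rsub_val u')).2 = 0.
Proof.
have /f_min/dvdpP[h hE] : ppoly_at a (theta (rsub_val u)).1 = 0 by exact/eqP/(valP u).
rewrite /ppoly_shift hE poly_shiftM.
have := f_central (rsub_val u'); rewrite wreathE /= bracket0l addr0.
rewrite (lin0 (ppoly_shift_linear _)) subr0 => /(congr1 snd) /= f0.
by rewrite [X in poly_shift h X]f0 (lin0 (poly_shift_linear _)).
Qed.

Lemma kernel_value_hom : rlie_hom kernel_value.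
Proof.
have [lth bth rth] := htheta; split=> [c u u'|u u'|u].
- by rewrite /kernel_value [rsub_val _]/= lth.
- by rewrite /kernel_value [rsub_val _]/= bth wreathE /= !kernel_shift0 subrr add0r.
rewrite /kernel_value [rsub_val _]/= rth wreath_rpowE jacobson_sum_commuting //; last first.
  by rewrite bracket_top_base kernel_shift0.
by rewrite addr0 /= add0r.
Qed.
End Evaluation.

Theorem proposition1 (p : nat) (F : fieldType) (hF : perfect_pchar p F)
    (n m : nat) (hmn : (m + 2 <= n)%N)
    (G : rlieType p F) (hG : rlie_presented n m G) :
  exists N : nat, forall A : rlieVectType p F,
    rlie_cyclic A -> (N <= \dim (fullv : {vspace A}))%N ->
    exists M : rideal G,
      rlie_isom (rquot M) A /\
      exists (H : rlieType p F) (f : rsub (rideal_rsubalg M) -> H),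
        [/\ rlie_free H, ~ rlie_abelian H, rlie_hom f
          & forall h : H, exists u, f u = h].
Proof.
pose pF := hF.1; have [L [x0 [w [free0 [e [he [e' eK e'K]]]]]]] := hG.
have n_gt1 : (1 < n)%N by rewrite (leq_trans _ hmn) // addn2.
pose pi l : G := e' (rquot_pi (rideal_gen w) l).
have hpi : rlie_hom pi.
  exact: (rlie_hom_comp (rlie_hom_inverse he eK e'K) (rquot_pi_hom (rideal_gen w))).
have pi_surj g : exists l, pi l = g.
  by exists (repr (e g)); rewrite /pi rquot_reprK eK.
have pi_lift (K : rlieType p F) (Phi : L -> K) : rlie_hom Phi -> (forall j, Phi (w j) = 0) ->
    exists theta : G -> K, rlie_hom theta /\ forall l, theta (pi l) = Phi l.
  move=> hPhi Phiw; have [th [hth thE]] := quotient_lift hPhi (rideal_gen_killed pF hPhi Phiw).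
  exists (fun g => th (e g)); split; first exact: rlie_hom_comp.
  by move=> l; rewrite /pi e'K thE.
have [x [rho [i0 [[free dual] rho_ws]]]] : exists x rho i,
    @dual_frame p F hF L n x rho /\ forall z, z \in codom w -> rho i z = 0.
  by apply: dual_frame_kill free0 _; rewrite size_codom card_ord (leq_trans _ hmn) // addn2 ltnW.
have [hrho rho_x] := dual i0.
have rho_w j : rho i0 (w j) = 0 by apply/rho_ws/codom_f.
have [H [y freeH]] := free_rank_two pF free n_gt1.
have /choice[KP hKP] j : exists KP : nat * ('I_n -> {poly F}),
    'X * KP.2 i0 = ppoly_eval p (rho i0 (w j)) /\
    forall (g : 'I_n -> jets H) (Phi : L -> wreath H pF), small_jets KP.1 g -> rlie_hom Phi ->
    (forall l, Phi (x l) = (rho i0 (x l), g l)) -> Phi (w j) = (rho i0 (w j), jet_comb KP.2 g).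
  have [K [P KP]] := @linear_part p F pF L H n x i0 (rho i0) free hrho rho_x (w j).
  by exists (K, P).
pose K := \max_j (KP j).1.
(* A bound that ensures n (2 K + 1) < d, hence enough unknowns. *)
exists (n * (K + K).+1).+1 => A cycA dimA.
have [a [f [mf fa0 f_min surj_a le_dim]]] := cyclic_generator pF cycA.
have sf : size f = (size f).-1.+1 by rewrite prednK // size_poly_gt0 monic_neq0.
have small_word j (g : 'I_n -> jets H) (Phi : L -> wreath H pF) : small_jets K g ->
    rlie_hom Phi -> (forall l, Phi (x l) = (rho i0 (x l), g l)) ->
    Phi (w j) = (rho i0 (w j), jet_comb (KP j).2 g).
  move=> sg; apply: (hKP j).2; apply: small_jetsW sg.
  exact: (@leq_bigmax _ (fun j => (KP j).1)).
have P_i0 j : (KP j).2 i0 = 0.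
  have /eqP := (hKP j).1; rewrite rho_w (lin0 (@ppoly_eval_linear p F)) mulf_eq0 polyX_eq0.
  by move/eqP.
have [Phi [hPhi Phi1 Phiw Phif [Phi_y [z [c [rho_z c0 Phi_z]]]]]] :=
  wreath_hom_exists free hrho rho_x rho_w P_i0 small_word hmn (y true) (y false) mf sf
    (leq_trans dimA le_dim).
have [theta [htheta thetaE]] := pi_lift _ Phi hPhi Phiw.
have f_central g : ⁅top pF H f, theta g⁆ = 0 by have [l <-] := pi_surj g; rewrite thetaE.
pose M := hom_kernel pF (cyclic_projection_hom a htheta).
have projE l : cyclic_projection theta a (pi l) = ppoly_at a (rho i0 l).
  by rewrite /cyclic_projection thetaE Phi1.
have proj_at r : ppoly_at a (rho i0 (ppoly_at (x i0) r)) = ppoly_at a r.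
  rewrite (rlie_hom_ppoly_at _ _ hrho) rho_x eqxx.
  rewrite [LHS](rlie_hom_ppoly_at _ _ (ppoly_at_hom pF a)).
  by rewrite -(expr0 'X) ppoly_atXn.
exists M; split.
  apply: quotient_kernel_isom => b; have [r ->] := surj_a b.
  by exists (pi (ppoly_at (x i0) r)); rewrite projE proj_at.
pose val_M : rsub (rideal_rsubalg M) -> H := @kernel_value p F pF G H A theta a htheta.
have hval : rlie_hom val_M by exact: (kernel_value_hom htheta f_min f_central).
have [lval bval rval] := hval.
have val_pi l : ppoly_at a (rho i0 l) = 0 -> exists u, val_M u = (Phi l).2 0%N.
  rewrite -projE => /eqP inM; exists (RSub (inM : pi l \in rideal_rsubalg M)).
  by rewrite /val_M /kernel_value /= thetaE.
exists H, val_M; split=> //.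
- by exists bool, y.
- exact: free_rank_two_nonabelian freeH.
apply: (free_induction freeH) => [|k h h' [u <-] [u' <-]|h h' [u <-] [u' <-]|h [u <-]|[]].
- by exists 0; rewrite (lin0 lval).
- by exists (k *: u + u'); rewrite lval.
- by exists ⁅u, u'⁆; rewrite bval.
- by exists u^[p]; rewrite rval.
- by rewrite -Phi_y; apply: val_pi; rewrite proj_at.
have [u hu] : exists u, val_M u = (Phi z).2 0%N.
  by apply: val_pi; rewrite rho_z (lin0 (rlie_hom_linear (ppoly_at_hom pF a))).
by exists (c^-1 *: u); rewrite (linZ lval) hu Phi_z scalerA mulVf // scale1r.
Qed.
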